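(* Suppose that $\operatorname{clos} J_{\min}\neq J_{\max}$. For $t\in\mathbb{R}\cup\{\infty\}$ let $J_t$ be the self-adjoint extension of $J_{\min}$ with $J_t u=\mathcal{J}u$ and domain $$\mathcal{D}(J_t)=\mathsf{D}\dotplus\{t\,p(0)+q(0)\}\quad (t\in\mathbb{R}),\qquad \mathcal{D}(J_\infty)=\mathsf{D}\dotplus\{p(0)\}.$$ Then for all $z\in\mathbb{C}$ with $\operatorname{Im} z\neq 0$ and all $h\in\ell^2(\mathbb{Z}_+)$, the resolvent $R_t(z)=(J_t-zI)^{-1}$ is given by $$R_t(z)h=\gamma_t(z)\,\langle h,p(\bar z)\rangle\, p(z)+\mathcal{R}(z)h,$$ where $$\gamma_t(z)=\frac{z\langle q(z),q(0)\rangle+\big(1+z\langle q(z),p(0)\rangle\big)t}{1-z\langle p(z),q(0)\rangle-z\langle p(z),p(0)\rangle t},\qquad t\in\mathbb{R},$$ and $$\gamma_\infty(z)=-\frac{1+z\langle q(z),p(0)\rangle}{z\langle p(z),p(0)\rangle}.$$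
   Context: Let $\mathbb{Z}_+=\{0,1,2,\dots\}$, let $a_n>0$ and $b_n\in\mathbb{R}$ for $n\in\mathbb{Z}_+$, and for a sequence $u=(u_n)_{n\ge 0}$ of complex numbers put $(\mathcal{J}u)_0=b_0u_0+a_0u_1$ and $(\mathcal{J}u)_n=a_{n-1}u_{n-1}+b_nu_n+a_nu_{n+1}$ for $n\ge 1$. For $z\in\mathbb{C}$, $p(z)=(p_n(z))_{n\ge0}$ and $q(z)=(q_n(z))_{n\ge0}$ are the solutions of $a_{n-1}u_{n-1}+b_nu_n+a_nu_{n+1}=zu_n$, $n\ge1$, with $p_0(z)=1$, $p_1(z)=(z-b_0)/a_0$, $q_0(z)=0$, $q_1(z)=1/a_0$. The space $\ell^2(\mathbb{Z}_+)$ has scalar product $\langle u,v\rangle=\sum_n u_n\overline{v_n}$. The operator $J_{\min}$ acts by $J_{\min}u=\mathcal{J}u$ on the set $\mathcal{D}$ of finitely supported sequences; $J_{\max}$ acts by $J_{\max}u=\mathcal{J}u$ on $\mathcal{D}(J_{\max})=\{u\in\ell^2(\mathbb{Z}_+):\mathcal{J}u\in\ell^2(\mathbb{Z}_+)\}$; one has $J_{\min}^*=J_{\max}$. $\operatorname{clos}$ denotes operator closure and $\mathsf{D}:=\mathcal{D}(\operatorname{clos}J_{\min})$. $\{h\}$ denotes the one-dimensional span of a vector $h$ and $\dotplus$ the direct sum of subspaces. It is known that if $\operatorname{clos}J_{\min}\ne J_{\max}$ (limit circle case), then $p(z),q(z)\in\ell^2(\mathbb{Z}_+)$ for all $z\in\mathbb{C}$,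 and the operators $J_t$, $t\in\mathbb{R}\cup\{\infty\}$, are exactly all self-adjoint extensions of $J_{\min}$. In this case, for every $z\in\mathbb{C}$, $\mathcal{R}(z)$ is the bounded operator on $\ell^2(\mathbb{Z}_+)$ defined by $$(\mathcal{R}(z)h)_n=q_n(z)\sum_{m=0}^n p_m(z)h_m+p_n(z)\sum_{m=n+1}^\infty q_m(z)h_m .$$ *)

(* Defs.v *)
From Stdlib Require Import Reals Lra.
From Coquelicot Require Import Coquelicot.

Open Scope R_scope.
Open Scope C_scope.

Definition vect : Type := nat -> C.

Definition vadd (u v : vect) : vect := fun n => u n + v n.
Definition vsub (u v : vect) : vect := fun n => u n - v n.
Definition vscal (c : C) (u : vect) : vect := fun n => c * u n.

(* Coquelicot's total sum [Series] is real-valued; a complex series is summed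
   componentwise. *)
Definition CSeries (x : nat -> C) : C :=
  (Series (fun n => Re (x n)), Series (fun n => Im (x n))).

Definition l2 (u : vect) : Prop := ex_series (fun n => (Cmod (u n) ^ 2)%R).

(* Meaningful on [l2] only: [Series] takes a default value when the series
   diverges. *)
Definition l2norm (u : vect) : R := sqrt (Series (fun n => (Cmod (u n) ^ 2)%R)).
Definition inner (u v : vect) : C := CSeries (fun n => u n * Cconj (v n)).

(* A (possibly unbounded) operator in l2 is represented by its graph:
   [T u v] means that u is in the domain and T u = v. *)
Definition operator : Type := vect -> vect -> Prop.

Definition dom (T : operator) (u : vect) : Prop := exists v, T u v.

Definition op_eq (S T : operator) : Prop := forall u v, S u v <-> T u v.

(* Closure of the graph in l2 x l2. *)
Definition clos (T : operator) : operator := fun u v =>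
  l2 u /\ l2 v /\
  exists x y : nat -> vect,
    (forall k, T (x k) (y k)) /\
    is_lim_seq (fun k => l2norm (vsub (x k) u)) 0%R /\
    is_lim_seq (fun k => l2norm (vsub (y k) v)) 0%R.

(* (T - z I)^-1, as the converse of the graph of T - z I. *)
Definition resolvent (T : operator) (z : C) : operator := fun h u =>
  exists v, T u v /\ h = vsub v (vscal z u).

Definition span (h w : vect) : Prop := exists c : C, w = vscal c h.

(* Direct sum of subspaces: the decomposition is required to be unique, so that
   membership expresses directness and not only u in U + W. *)
Definition dsum (U W : vect -> Prop) (u : vect) : Prop :=
  exists! d : vect * vect, U (fst d) /\ W (snd d) /\ u = vadd (fst d) (snd d).

Definition calJ (a b : nat -> R) (u : vect) : vect := fun n =>
  match n with
  | O => b O * u O + a O * u 1%nat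
  | S m => a m * u m + b (S m) * u (S m) + a (S m) * u (S (S m))
  end.

(* The pair (u_n, u_(n+1)) of the solution with initial values u_0, u_1. *)
Fixpoint sol_pair (a b : nat -> R) (z u0 u1 : C) (n : nat) : C * C :=
  match n with
  | O => (u0, u1)
  | S m =>
      let (x, y) := sol_pair a b z u0 u1 m in
      (y, ((z - b (S m)) * y - a m * x) / a (S m))
  end.

Definition p (a b : nat -> R) (z : C) : vect :=
  fun n => fst (sol_pair a b z 1 ((z - b O) / a O) n).
Definition q (a b : nat -> R) (z : C) : vect :=
  fun n => fst (sol_pair a b z 0 (1 / a O) n).

Lemma sol_pair_rec (a b : nat -> R) (z u0 u1 : C) (m : nat) :
  (forall n, (0 < a n)%R) ->
  let u := fun n => fst (sol_pair a b z u0 u1 n) in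
  u O = u0 /\ u 1%nat = u1 /\
  a m * u m + b (S m) * u (S m) + a (S m) * u (S (S m)) = z * u (S m).
Proof.
intros ha u; unfold u; split; [reflexivity|split; [reflexivity|]].
simpl; destruct (sol_pair a b z u0 u1 m) as [x y]; simpl.
field.
intros H; apply RtoC_inj in H; specialize (ha (S m)); lra.
Qed.

Definition Jmin (a b : nat -> R) : operator := fun u v =>
  (exists N, forall n, (N <= n)%nat -> u n = 0) /\ v = calJ a b u.

Definition Jmax (a b : nat -> R) : operator := fun u v =>
  l2 u /\ l2 (calJ a b u) /\ v = calJ a b u.

(* A parameter t in R u {oo} is an [option R], with [None] for oo. *)
Definition bvec (a b : nat -> R) (t : option R) : vect :=
  match t with
  | Some t => vadd (vscal t (p a b 0)) (q a b 0)
  | None => p a b 0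
  end.

Definition Jt (a b : nat -> R) (t : option R) : operator := fun u v =>
  dsum (dom (clos (Jmin a b))) (span (bvec a b t)) u /\ v = calJ a b u.

Definition calR (a b : nat -> R) (z : C) (h : vect) : vect := fun n =>
  q a b z n * sum_n (fun m => p a b z m * h m) n
  + p a b z n * CSeries (fun k => q a b z (n + 1 + k)%nat * h (n + 1 + k)%nat).

Definition gamma_den (a b : nat -> R) (z : C) (t : option R) : C :=
  match t with
  | Some t =>
      1 - z * inner (p a b z) (q a b 0) - z * inner (p a b z) (p a b 0) * t
  | None => z * inner (p a b z) (p a b 0)
  end.

Definition gamma (a b : nat -> R) (z : C) (t : option R) : C :=
  match t with
  | Some t =>
      (z * inner (q a b z) (q a b 0) + (1 + z * inner (q a b z) (p a b 0)) * t)
      / gamma_den a b z (Some t)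
  | None => - ((1 + z * inner (q a b z) (p a b 0)) / gamma_den a b z None)
  end.

(* Main.v *)
(* With B(u, v) = sum (Ju v - u Jv), the boundary form on the domain of Jmax,
   clos Jmin has domain {u | B(u, p(0)) = B(u, q(0)) = 0} and Jt has domain
   {u | B(u, beta) = 0}, where beta = t p(0) + q(0) (or p(0)): given Ju = f with
   sum p(0) f = 0, a finite rank perturbation of the truncations of f stays
   orthogonal to p(0), and calR maps it to a finitely supported sequence. The same
   approximation at the point z shows B(calR(z) h, .) = <h, p(conj z)> B(q(z), .),
   so a multiple c p(z) + calR(z) h lies in the domain of Jt exactly when
   c B(p(z), beta) + <h, p(conj z)> B(q(z), beta) = 0. The coefficient B(p(z), beta)
   does not vanish because Jt is symmetric.

   Square summability of p(z), q(z), p(0), q(0) is derived from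
   clos Jmin <> Jmax: if p(z) is not in l2, the range of Jmin - z is dense, which
   forces clos Jmin = Jmax; q(z) is then handled by Weyl's nested circles, and the
   passage from z to 0 by variation of constants. *)

Require Import Defs.
From Stdlib Require Import Reals Lra Lia Classical ClassicalEpsilon FunctionalExtensionality.
From Coquelicot Require Import Coquelicot.

Local Open Scope R_scope.
Local Open Scope C_scope.

(** * Series and l2 *)

(** B carries no conjugation. Since p(0) and q(0) are real, the numerator and denominator of [gamma]
    are values of B up to sign, and gamma is just -B(q(z), beta) / B(p(z), beta). Because B is
    alternating, beta satisfies its own boundary condition B(beta, beta) = 0, which is how one
    vector can describe the domain of [Jt]. The sequence [e0] links the two solutions: p_0 = 1, so
    subtracting a multiple of [e0] makes any h orthogonal to p(z), and calR(z) sends [e0] to q(z).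
    The boundary vectors live at the real point 0, while every a priori estimate has the factor Im z
    and so gives information at non-real points only. This is why square summability is first
    obtained at z and only then moved to 0. *)

Definition nrm2 (u : vect) : R := Series (fun n => (Cmod (u n) ^ 2)%R).

Definition summable (x : nat -> C) : Prop := ex_series (fun n => Cmod (x n)).

Lemma ex_series_le_R (x y : nat -> R) :
  (forall n, Rabs (x n) <= y n)%R -> ex_series y -> ex_series x.
Proof. intros H; apply (@ex_series_le R_AbsRing R_CompleteNormedModule); exact H. Qed.

Lemma ex_series_ext_R (x y : nat -> R) :
  (forall n, x n = y n) -> ex_series x -> ex_series y.
Proof. apply (@ex_series_ext R_AbsRing R_NormedModule). Qed.

Lemma ex_series_plus_R (x y : nat -> R) :
  ex_series x -> ex_series y -> ex_series (fun n => x n + y n)%R.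
Proof. apply (@ex_series_plus R_AbsRing R_NormedModule). Qed.

Lemma ex_series_scal_R (k : R) (x : nat -> R) :
  ex_series x -> ex_series (fun n => k * x n)%R.
Proof. apply (@ex_series_scal_l R_AbsRing). Qed.

Lemma ex_series_shift_R (x : nat -> R) (n : nat) :
  ex_series x <-> ex_series (fun k => x (n + k)%nat).
Proof. apply (@ex_series_incr_n R_AbsRing R_NormedModule). Qed.

Lemma rsum_S (x : nat -> R) (n : nat) : sum_n x (S n) = (sum_n x n + x (S n))%R :> R.
Proof. now rewrite sum_Sn. Qed.

Lemma rsum_le (x y : nat -> R) (N : nat) :
  (forall n, (n <= N)%nat -> (x n <= y n)%R) -> (sum_n x N <= sum_n y N)%R.
Proof.
  induction N as [|N IH]; intros H; [rewrite !sum_O; now apply H|].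
  rewrite !rsum_S; apply Rplus_le_compat; auto.
Qed.

Lemma rsum_scal (k : R) (x : nat -> R) (N : nat) :
  sum_n (fun n => (k * x n)%R) N = (k * sum_n x N)%R :> R.
Proof.
  induction N as [|N IH]; [now rewrite !sum_O|].
  rewrite !rsum_S, IH; ring.
Qed.

Lemma rsum_plus (x y : nat -> R) (N : nat) :
  sum_n (fun n => (x n + y n)%R) N = (sum_n x N + sum_n y N)%R :> R.
Proof.
  induction N as [|N IH]; [now rewrite !sum_O|].
  rewrite !rsum_S, IH; ring.
Qed.

Lemma csum_S (x : nat -> C) (n : nat) : sum_n x (S n) = sum_n x n + x (S n) :> C.
Proof. now rewrite sum_Sn. Qed.

Lemma csum_ext (x y : nat -> C) (N : nat) :
  (forall n, (n <= N)%nat -> x n = y n) -> sum_n x N = sum_n y N :> C.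
Proof. intros H; apply sum_n_ext_loc; exact H. Qed.

Lemma csum_scal (c : C) (x : nat -> C) (N : nat) :
  sum_n (fun n => c * x n) N = c * sum_n x N :> C.
Proof.
  induction N as [|N IH]; [now rewrite !sum_O|].
  rewrite !csum_S, IH; ring.
Qed.

Lemma csum_linear (c : C) (x y : nat -> C) (N : nat) :
  sum_n (fun n => x n + c * y n) N = sum_n x N + c * sum_n y N :> C.
Proof.
  induction N as [|N IH]; [now rewrite !sum_O|].
  rewrite !csum_S, IH; ring.
Qed.

Lemma Cmod_csum (x : nat -> C) (N : nat) :
  (Cmod (sum_n x N) <= sum_n (fun n => Cmod (x n)) N)%R.
Proof. apply (norm_sum_n_m (K := C_AbsRing) (V := C_NormedModule)). Qed.

Lemma csum_RtoC (x : nat -> R) (N : nat) :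
  sum_n (fun n => RtoC (x n)) N = RtoC (sum_n x N) :> C.
Proof.
  induction N as [|N IH]; [now rewrite !sum_O|].
  now rewrite csum_S, rsum_S, RtoC_plus, IH.
Qed.

Lemma lim0_le (x y : nat -> R) (M : R) :
  (forall k, 0 <= x k <= M * y k)%R -> is_lim_seq y 0%R -> is_lim_seq x 0%R.
Proof.
  intros H Hy; apply is_lim_seq_le_le with (fun _ => 0%R) (fun k => M * y k)%R; auto.
  - apply is_lim_seq_const.
  - replace 0%R with (M * 0)%R by ring; apply is_lim_seq_mult'; [apply is_lim_seq_const|easy].
Qed.

Lemma lim0_unique (x : nat -> R) (M : R) :
  (forall k, M <= x k)%R -> is_lim_seq x 0%R -> (M <= 0)%R.
Proof.
  intros H Hx.
  exact (is_lim_seq_le (fun _ => M) x M 0%R H (is_lim_seq_const M) Hx).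
Qed.

Lemma Cmod_le_abs (c : C) : (Cmod c <= Rabs (Re c) + Rabs (Im c))%R.
Proof.
  destruct c as [x y]; simpl.
  replace (x, y) with (RtoC x + Ci * RtoC y) by
    (unfold Ci, RtoC, Cplus, Cmult; simpl; f_equal; ring).
  eapply Rle_trans; [apply Cmod_triangle|].
  rewrite Cmod_mult, Cmod_Ci, !Cmod_R; lra.
Qed.

Lemma im_le_Cmod (c : C) : (Rabs (Im c) <= Cmod c)%R.
Proof. eapply Rle_trans; [apply Rmax_r|apply (Rmax_Cmod c)]. Qed.

Lemma Cmod_le0 (c : C) : (Cmod c <= 0)%R -> c = 0.
Proof. intros H; apply Cmod_eq_0; pose proof (Cmod_ge_0 c); lra. Qed.

Lemma Cmod_sqr_plus (x y : C) :
  (Cmod (x + y) ^ 2 <= 2 * Cmod x ^ 2 + 2 * Cmod y ^ 2)%R.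
Proof.
  pose proof (Cmod_triangle x y); pose proof (Cmod_ge_0 (x + y)).
  pose proof (pow2_ge_0 (Cmod x - Cmod y)); nra.
Qed.

Lemma Rsqr_le_reg (x y : R) : (0 <= y -> x ^ 2 <= y ^ 2 -> x <= y)%R.
Proof. intros; nra. Qed.

Lemma summable_Re (x : nat -> C) : summable x -> ex_series (fun n => Re (x n)).
Proof. apply ex_series_le_R; intros n; apply re_le_Cmod. Qed.

Lemma summable_Im (x : nat -> C) : summable x -> ex_series (fun n => Im (x n)).
Proof. apply ex_series_le_R; intros n; apply im_le_Cmod. Qed.

Lemma summable_scal (c : C) (x : nat -> C) :
  summable x -> summable (fun n => c * x n).
Proof.
  intros Hx; apply ex_series_ext_R with (fun n => Cmod c * Cmod (x n))%R.
  - intros n; now rewrite Cmod_mult.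
  - exact (ex_series_scal_R (Cmod c) _ Hx).
Qed.

Lemma summable_incr (x : nat -> C) (n : nat) :
  summable x -> summable (fun k => x (n + k)%nat).
Proof.
  exact (proj1 (ex_series_shift_R (fun k => Cmod (x k)) n)).
Qed.

Lemma CSeries_ext (x y : nat -> C) :
  (forall n, x n = y n) -> CSeries x = CSeries y.
Proof.
  intros H; unfold CSeries; f_equal; apply Series_ext; intros n; now rewrite H.
Qed.

Lemma CSeries_plus (x y : nat -> C) : summable x -> summable y ->
  CSeries (fun n => x n + y n) = CSeries x + CSeries y.
Proof.
  intros Hx Hy; unfold CSeries, Cplus; simpl.
  f_equal; apply Series_plus; auto using summable_Re, summable_Im.
Qed.

Lemma CSeries_scal (c : C) (x : nat -> C) : summable x ->
  CSeries (fun n => c * x n) = c * CSeries x.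
Proof.
  intros Hx; pose proof (summable_Re x Hx); pose proof (summable_Im x Hx).
  destruct c as [c d]; unfold CSeries, Cmult; simpl.
  f_equal.
  - rewrite Series_minus by auto using ex_series_scal_R; now rewrite !Series_scal_l.
  - rewrite Series_plus by auto using ex_series_scal_R; now rewrite !Series_scal_l.
Qed.

Lemma CSeries_linear (c : C) (x y : nat -> C) : summable x -> summable y ->
  CSeries (fun n => x n + c * y n) = CSeries x + c * CSeries y.
Proof.
  intros Hx Hy; rewrite CSeries_plus, CSeries_scal by auto using summable_scal; easy.
Qed.

Lemma CSeries_conj (x : nat -> C) :
  CSeries (fun n => Cconj (x n)) = Cconj (CSeries x).
Proof. unfold CSeries, Cconj; simpl; f_equal; apply Series_opp. Qed.

Lemma CSeries_split (x : nat -> C) (n : nat) : summable x ->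
  CSeries x = sum_n x n + CSeries (fun k => x (S n + k)%nat).
Proof.
  intros Hx; induction n as [|n IH].
  - rewrite sum_O; unfold CSeries, Cplus; simpl.
    f_equal; apply (Series_incr_1 (fun n => _ (x n)));
      auto using summable_Re, summable_Im.
  - rewrite IH, csum_S, <- Cplus_assoc; f_equal.
    pose proof (summable_incr x (S n) Hx) as Hs.
    unfold CSeries, Cplus; simpl; f_equal.
    + rewrite (Series_incr_1 (fun k => Re (x (S (n + k))))) by (exact (summable_Re _ Hs)).
      rewrite Nat.add_0_r; f_equal; apply Series_ext; intros k; do 3 f_equal; lia.
    + rewrite (Series_incr_1 (fun k => Im (x (S (n + k))))) by (exact (summable_Im _ Hs)).
      rewrite Nat.add_0_r; f_equal; apply Series_ext; intros k; do 3 f_equal; lia.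
Qed.

Lemma CSeries_0 (x : nat -> C) : (forall n, x n = 0) -> CSeries x = 0.
Proof.
  intros H; unfold CSeries, RtoC; f_equal;
    (* [Series_scal_l] holds without a convergence hypothesis, so writing the terms as [0 * 0]
       evaluates the zero series. *)
    rewrite (Series_ext _ (fun n => 0 * 0)%R), ?Series_scal_l; try ring;
    intros n; rewrite H; simpl; ring.
Qed.

Lemma ex_series_finite (x : nat -> R) (N : nat) :
  (forall n, (N <= n)%nat -> x n = 0%R) -> ex_series x.
Proof.
  intros H; apply (proj2 (ex_series_shift_R x N)).
  exists 0%R; apply filterlim_ext with (fun _ : nat => 0%R).
  - intros n; symmetry; rewrite (sum_n_ext _ (fun _ => 0%R)).
    + rewrite sum_n_const; ring.
    + intros k; apply H; lia.
  - apply filterlim_const.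
Qed.

Lemma summable_finite (x : nat -> C) (N : nat) :
  (forall n, (N <= n)%nat -> x n = 0) -> summable x.
Proof.
  intros H; apply ex_series_finite with N; intros n Hn; rewrite H by easy; apply Cmod_0.
Qed.

Lemma CSeries_finite (x : nat -> C) (N : nat) :
  (forall n, (N < n)%nat -> x n = 0) -> CSeries x = sum_n x N.
Proof.
  intros H; rewrite (CSeries_split x N).
  - rewrite CSeries_0 by (intros n; apply H; lia); ring.
  - apply summable_finite with (S N); intros n Hn; apply H; lia.
Qed.

(** The factor 2 comes from estimating real and imaginary parts separately. It is harmless, and it
    is the origin of the constants 4, 8 and 10 in later bounds. *)
Lemma Cmod_CSeries (x : nat -> C) : summable x ->
  (Cmod (CSeries x) <= 2 * Series (fun n => Cmod (x n)))%R.
Proof.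
  intros Hx; eapply Rle_trans; [apply Cmod_le_abs|]; simpl.
  assert (H : forall f : C -> R, (forall c, Rabs (f c) <= Cmod c)%R ->
    (Rabs (Series (fun n => f (x n))) <= Series (fun n => Cmod (x n)))%R).
  { intros f Hf; eapply Rle_trans; [apply Series_Rabs|].
    - apply ex_series_le_R with (2 := Hx); intros n; rewrite Rabs_Rabsolu; apply Hf.
    - apply Series_le; [|exact Hx]; intros n; split; [apply Rabs_pos|apply Hf]. }
  pose proof (H Re re_le_Cmod); pose proof (H Im im_le_Cmod); lra.
Qed.

Lemma Series_nonneg (x : nat -> R) :
  ex_series x -> (forall n, 0 <= x n)%R -> (0 <= Series x)%R.
Proof.
  intros Hx H.
  replace 0%R with (Series (fun n => 0 * x n)%R) by (rewrite Series_scal_l; ring).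
  apply Series_le; [|exact Hx]; intros n; specialize (H n); lra.
Qed.

Lemma sum_n_le_Series (x : nat -> R) (N : nat) :
  ex_series x -> (forall n, 0 <= x n)%R -> (sum_n x N <= Series x)%R.
Proof.
  intros Hx H.
  rewrite (Series_incr_n x (S N)) by (lia || easy); simpl pred.
  rewrite <- sum_n_Reals.
  assert (0 <= Series (fun k => x (S N + k)%nat))%R; [|lra].
  apply Series_nonneg; [|intros; apply H].
  exact (proj1 (ex_series_shift_R x (S N)) Hx).
Qed.

Lemma term_le_Series (x : nat -> R) (N : nat) :
  ex_series x -> (forall n, 0 <= x n)%R -> (x N <= Series x)%R.
Proof.
  intros Hx H; eapply Rle_trans; [|apply (sum_n_le_Series x N); easy].
  destruct N as [|N]; [rewrite sum_O; lra|].
  rewrite sum_Sn; unfold plus; simpl.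
  assert (0 <= sum_n x N)%R; [|lra].
  clear - H; induction N as [|N IH]; [rewrite sum_O; apply H|].
  rewrite sum_Sn; unfold plus; simpl; specialize (H (S N)); lra.
Qed.

Lemma ex_series_bounded (x : nat -> R) (M : R) : (forall n, 0 <= x n)%R ->
  (forall N, sum_n x N <= M)%R -> ex_series x /\ (Series x <= M)%R.
Proof.
  intros H HM.
  assert (Hg : Un_growing (sum_f_R0 x)).
  { intros n; simpl; specialize (H (S n)); lra. }
  destruct (growing_cv _ Hg) as [l Hl].
  { exists M; intros y [n ->]; rewrite <- sum_n_Reals; apply HM. }
  assert (Hs : is_series x l) by (apply is_series_Reals; exact Hl).
  split; [now exists l|].
  rewrite (is_series_unique _ _ Hs).
  apply Rnot_lt_le; intros Hlt.
  destruct (Hl (l - M)%R) as [N HN]; [lra|].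
  specialize (HN N (Nat.le_refl N)); specialize (HM N).
  rewrite sum_n_Reals in HM; unfold Rdist in HN; apply Rabs_def2 in HN; lra.
Qed.

Lemma rsum_unbounded (x : nat -> R) (M : R) : (forall n, 0 <= x n)%R ->
  ~ ex_series x -> exists K, (M < sum_n x K)%R.
Proof.
  intros Hx H; apply NNPP; intros N; apply H.
  apply (ex_series_bounded x M Hx); intros K; apply Rnot_lt_le; intros L; now apply N; exists K.
Qed.

Lemma Series_tail_lim (x : nat -> R) : ex_series x ->
  is_lim_seq (fun N => Series (fun k => x (S N + k)%nat)) 0%R.
Proof.
  intros Hx; apply is_lim_seq_ext with (fun N => Series x - sum_n x N)%R.
  - intros N; rewrite (Series_incr_n x (S N)) by (lia || easy); simpl pred.
    rewrite <- sum_n_Reals; ring.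
  - replace 0%R with (Series x - Series x)%R by ring.
    apply is_lim_seq_minus'; [apply is_lim_seq_const|].
    exact (Series_correct x Hx).
Qed.

Lemma Series_truncate (x : nat -> R) (N : nat) :
  Series (fun n => if Nat.leb n N then 0%R else x n) = Series (fun k => x (S N + k)%nat).
Proof.
  rewrite (Series_incr_n_aux _ (S N)).
  - apply Series_ext; intros k; now rewrite (proj2 (Nat.leb_gt _ _)) by lia.
  - intros k Hk; now rewrite (proj2 (Nat.leb_le _ _)) by lia.
Qed.

Lemma Series_finite (x : nat -> R) (N : nat) :
  (forall n, (N < n)%nat -> x n = 0%R) -> Series x = sum_n x N.
Proof.
  intros H; rewrite (Series_incr_n x (S N)).
  - simpl pred; rewrite <- sum_n_Reals, (Series_ext _ (fun _ => 0 * 0)%R), Series_scal_l.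
    + ring.
    + intros k; rewrite H by lia; ring.
  - lia.
  - apply ex_series_finite with (S N); intros n Hn; apply H; lia.
Qed.

Lemma CSeries_tail_lim (x : nat -> C) : summable x ->
  is_lim_seq (fun N => Cmod (CSeries x - sum_n x N)) 0%R.
Proof.
  intros Hx.
  apply lim0_le with (fun N => Series (fun k => Cmod (x (S N + k)%nat))) 2%R.
  - intros N; split; [apply Cmod_ge_0|].
    rewrite (CSeries_split x N) by easy.
    replace (_ + _ - _) with (CSeries (fun k => x (S N + k)%nat)) by ring.
    apply Cmod_CSeries, (summable_incr x (S N) Hx).
  - exact (Series_tail_lim _ Hx).
Qed.

Lemma quadratic_nonneg_discriminant (A B D : R) :
  (0 <= A)%R -> (forall s : R, 0 <= A * s ^ 2 + 2 * B * s + D)%R -> (B ^ 2 <= A * D)%R.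
Proof.
  intros HA H; destruct (Req_dec A 0) as [->|HA0].
  - destruct (Req_dec B 0) as [->|HB]; [specialize (H 0%R); lra|].
    (* With A = 0 the polynomial is affine and equals -1 at this point. *)
    specialize (H (- (D + 1) / (2 * B))%R).
    replace (2 * B * (- (D + 1) / (2 * B)))%R with (- (D + 1))%R in H by (field; easy).
    lra.
  - specialize (H (- B / A)%R).
    replace (A * (- B / A) ^ 2 + 2 * B * (- B / A) + D)%R with
      ((A * D - B ^ 2) / A)%R in H by (field; easy).
    assert (0 <= (A * D - B ^ 2) / A * A)%R by (apply Rmult_le_pos; easy).
    replace ((A * D - B ^ 2) / A * A)%R with (A * D - B ^ 2)%R in H0 by (field; easy).
    lra.
Qed.

Lemma l2_mul_summable (u v : vect) : l2 u -> l2 v -> summable (fun n => u n * v n).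
Proof.
  intros Hu Hv.
  apply ex_series_le_R with (fun n => Cmod (u n) ^ 2 + Cmod (v n) ^ 2)%R.
  - intros n; rewrite Rabs_pos_eq by apply Cmod_ge_0; rewrite Cmod_mult.
    pose proof (pow2_ge_0 (Cmod (u n) - Cmod (v n))).
    pose proof (Cmod_ge_0 (u n)); pose proof (Cmod_ge_0 (v n)); nra.
  - exact (ex_series_plus_R _ _ Hu Hv).
Qed.

(** The squared norm of s|u| + |v| is a quadratic polynomial in s without negative values; its
    discriminant gives the bound. *)
Lemma Series_Cauchy_Schwarz (u v : vect) : l2 u -> l2 v ->
  (Series (fun n => Cmod (u n * v n)) ^ 2 <= nrm2 u * nrm2 v)%R.
Proof.
  intros Hu Hv; pose proof (l2_mul_summable u v Hu Hv) as Huv.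
  apply quadratic_nonneg_discriminant.
  - apply Series_nonneg; [exact Hu|intros; apply pow2_ge_0].
  - intros s; unfold nrm2.
    replace (_ * s ^ 2 + _ + _)%R with
      (Series (fun n => s ^ 2 * Cmod (u n) ^ 2 + 2 * s * Cmod (u n * v n) + Cmod (v n) ^ 2)%R).
    + apply Series_nonneg.
      * auto 6 using ex_series_plus_R, ex_series_scal_R.
      * intros n; rewrite Cmod_mult.
        replace (_ + _)%R with ((s * Cmod (u n) + Cmod (v n)) ^ 2)%R by ring.
        apply pow2_ge_0.
    + rewrite Series_plus, Series_plus, !Series_scal_l by auto using ex_series_plus_R, ex_series_scal_R; ring.
Qed.

Lemma nrm2_nonneg (u : vect) : l2 u -> (0 <= nrm2 u)%R.
Proof. intros Hu; apply Series_nonneg; [exact Hu|intros; apply pow2_ge_0]. Qed.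

Lemma Cmod_le_nrm2 (u : vect) (n : nat) : l2 u -> (Cmod (u n) ^ 2 <= nrm2 u)%R.
Proof.
  intros Hu; apply (term_le_Series (fun n => Cmod (u n) ^ 2)%R n Hu).
  intros; apply pow2_ge_0.
Qed.

Lemma Cmod_CSeries_mul (u v : vect) : l2 u -> l2 v ->
  (Cmod (CSeries (fun n => u n * v n)%C) ^ 2 <= 4 * (nrm2 u * nrm2 v))%R.
Proof.
  intros Hu Hv; pose proof (Series_Cauchy_Schwarz u v Hu Hv).
  pose proof (Cmod_CSeries _ (l2_mul_summable u v Hu Hv)).
  pose proof (Cmod_ge_0 (CSeries (fun n => u n * v n))); nra.
Qed.

Lemma l2_ext (u v : vect) : (forall n, u n = v n) -> l2 u -> l2 v.
Proof. intros H; apply ex_series_ext_R; intros n; now rewrite H. Qed.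

Lemma nrm2_ext (u v : vect) : (forall n, u n = v n) -> nrm2 u = nrm2 v.
Proof. intros H; apply Series_ext; intros n; now rewrite H. Qed.

Lemma l2_plus (u v : vect) : l2 u -> l2 v ->
  l2 (fun n => u n + v n) /\
  (nrm2 (fun n => (u n + v n)%C) <= 2 * nrm2 u + 2 * nrm2 v)%R.
Proof.
  intros Hu Hv.
  assert (E : ex_series (fun n => 2 * Cmod (u n) ^ 2 + 2 * Cmod (v n) ^ 2)%R).
  { auto using ex_series_plus_R, ex_series_scal_R. }
  split.
  - apply ex_series_le_R with (2 := E); intros n.
    rewrite Rabs_pos_eq by apply pow2_ge_0; apply Cmod_sqr_plus.
  - unfold nrm2; rewrite <- !Series_scal_l, <- Series_plus by auto using ex_series_scal_R.
    apply Series_le; [|exact E]; intros n; split; [apply pow2_ge_0|apply Cmod_sqr_plus].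
Qed.

Lemma l2_scal (c : C) (u : vect) : l2 u -> l2 (fun n => c * u n).
Proof.
  intros Hu; apply ex_series_ext_R with (fun n => Cmod c ^ 2 * Cmod (u n) ^ 2)%R.
  - intros n; rewrite Cmod_mult; ring.
  - exact (ex_series_scal_R _ _ Hu).
Qed.

Lemma nrm2_scal (c : C) (u : vect) :
  nrm2 (fun n => c * u n) = (Cmod c ^ 2 * nrm2 u)%R.
Proof.
  unfold nrm2; rewrite <- Series_scal_l; apply Series_ext.
  intros n; rewrite Cmod_mult; ring.
Qed.

Lemma l2_minus (u v : vect) : l2 u -> l2 v ->
  l2 (fun n => u n - v n) /\
  (nrm2 (fun n => (u n - v n)%C) <= 2 * nrm2 u + 2 * nrm2 v)%R.
Proof.
  intros Hu Hv.
  assert (E : forall n, (Cmod (v n) ^ 2 = Cmod (- v n) ^ 2)%R) by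
    (intros n; now rewrite Cmod_opp).
  destruct (l2_plus u (fun n => - v n) Hu) as [H1 H2].
  - exact (ex_series_ext_R _ _ E Hv).
  - split; [exact H1|].
    replace (nrm2 v) with (nrm2 (fun n => - v n)); [exact H2|].
    symmetry; exact (Series_ext _ _ E).
Qed.

Lemma l2_conj (u : vect) : l2 u -> l2 (fun n => Cconj (u n)).
Proof. apply ex_series_ext_R; intros n; now rewrite Cmod_conj. Qed.

Lemma l2_finite (u : vect) (N : nat) :
  (forall n, (N <= n)%nat -> u n = 0) -> l2 u.
Proof.
  intros H; apply ex_series_finite with N; intros n Hn; rewrite H, Cmod_0 by easy; ring.
Qed.

(** * Convergence and completeness in l2 *)

Lemma l2norm_lim0 (x : nat -> vect) : (forall k, l2 (x k)) ->
  is_lim_seq (fun k => l2norm (x k)) 0%R <-> is_lim_seq (fun k => nrm2 (x k)) 0%R.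
Proof.
  intros H; split; intros Hl.
  - apply is_lim_seq_ext with (fun k => l2norm (x k) * l2norm (x k))%R.
    + intros k; apply sqrt_sqrt, nrm2_nonneg, H.
    + replace 0%R with (0 * 0)%R by ring; now apply is_lim_seq_mult'.
  - rewrite <- sqrt_0.
    apply (is_lim_seq_continuous sqrt (fun k => nrm2 (x k)) 0%R); [|exact Hl].
    apply continuity_pt_filterlim, continuous_sqrt.
Qed.

Lemma l2_lim_pointwise (x : nat -> vect) (u : vect) (n : nat) :
  (forall k, l2 (x k)) -> l2 u ->
  is_lim_seq (fun k => l2norm (vsub (x k) u)) 0%R ->
  is_lim_seq (fun k => Cmod (x k n - u n)) 0%R.
Proof.
  intros Hx Hu; apply lim0_le with (M := 1%R); intros k.
  split; [apply Cmod_ge_0|]; rewrite Rmult_1_l.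
  apply Rsqr_le_reg; [apply sqrt_pos|].
  assert (l2 (vsub (x k) u)) by now apply l2_minus.
  unfold l2norm; rewrite pow2_sqrt by now apply nrm2_nonneg.
  exact (Cmod_le_nrm2 (vsub (x k) u) n H).
Qed.

(** The Cauchy condition has an explicit rate [e], which survives the passage to the limit as the
    bound [e k] on the squared distance from [x k] to [y]. *)
Lemma l2_complete (x : nat -> vect) (e : nat -> R) :
  (forall k, l2 (x k)) ->
  (forall k l, nrm2 (fun n => (x k n - x l n)%C) <= e k + e l)%R ->
  is_lim_seq e 0%R ->
  exists y, l2 y /\ is_lim_seq (fun k => nrm2 (fun n => x k n - y n)) 0%R.
Proof.
  intros Hx He Le.
  assert (Hp : forall k l n, (Cmod (x k n - x l n)%C ^ 2 <= e k + e l)%R).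
  { intros k l n; eapply Rle_trans; [|apply He].
    apply (Cmod_le_nrm2 (fun n => (x k n - x l n)%C)); now apply l2_minus. }
  assert (Cau : forall (f : C -> R) n, (forall c d : C, f (c - d)%C = f c - f d)%R ->
    (forall c, Rabs (f c) <= Cmod c)%R -> ex_finite_lim_seq (fun k => f (x k n))).
  { intros f n Hf Hle; apply ex_lim_seq_cauchy_corr; intros eps.
    (* Both [e k] and [e l] stay below eps^2 / 2, so the squared distance of the coordinates is
       below eps^2. *)
    assert (P : (0 < eps ^ 2 / 2)%R) by (pose proof (cond_pos eps); nra).
    apply is_lim_seq_spec in Le; destruct (Le (mkposreal _ P)) as [N HN]; simpl in HN.
    exists N; intros k l Hk Hl; cbv beta; rewrite <- Hf; eapply Rle_lt_trans; [apply Hle|].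
    pose proof (HN k Hk) as H1; pose proof (HN l Hl) as H2.
    rewrite Rminus_0_r in H1, H2; apply Rabs_def2 in H1, H2.
    pose proof (Hp k l n); pose proof (cond_pos eps).
    pose proof (Cmod_ge_0 (x k n - x l n)); nra. }
  set (y := fun n => (real (Lim_seq (fun k => Re (x k n))),
                      real (Lim_seq (fun k => Im (x k n)))) : C).
  assert (LR : forall n, is_lim_seq (fun k => Re (x k n)) (Re (y n))).
  { intros n; apply Lim_seq_correct', Cau; [intros [] []; simpl; ring|apply re_le_Cmod]. }
  assert (LI : forall n, is_lim_seq (fun k => Im (x k n)) (Im (y n))).
  { intros n; apply Lim_seq_correct', Cau; [intros [] []; simpl; ring|apply im_le_Cmod]. }
  assert (LM : forall k n,
    is_lim_seq (fun l => Cmod (x k n - x l n)%C ^ 2)%R (Cmod (x k n - y n)%C ^ 2)%R).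
  { intros k n; rewrite Cmod2_alt.
    apply is_lim_seq_ext with
      (fun l => (Re (x k n) - Re (x l n)) * (Re (x k n) - Re (x l n)) +
                (Im (x k n) - Im (x l n)) * (Im (x k n) - Im (x l n)))%R.
    - intros l; rewrite Cmod2_alt; destruct (x k n), (x l n); simpl; ring.
    - replace (_ + _)%R with
        ((Re (x k n) - Re (y n)) * (Re (x k n) - Re (y n)) +
         (Im (x k n) - Im (y n)) * (Im (x k n) - Im (y n)))%R by (destruct (x k n), (y n); simpl; ring).
      apply is_lim_seq_plus'; apply is_lim_seq_mult'; apply is_lim_seq_minus';
        auto using is_lim_seq_const. }
  assert (LS : forall k N, is_lim_seq (fun l => sum_n (fun n => Cmod (x k n - x l n)%C ^ 2)%R N)
    (sum_n (fun n => Cmod (x k n - y n)%C ^ 2)%R N)).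
  { intros k N; induction N as [|N IH].
    - rewrite sum_O; apply is_lim_seq_ext with (2 := LM k O); intros l; now rewrite sum_O.
    - rewrite rsum_S.
      apply is_lim_seq_ext with (fun l => sum_n (fun n => Cmod (x k n - x l n)%C ^ 2) N +
        Cmod (x k (S N) - x l (S N))%C ^ 2)%R; [intros l; now rewrite rsum_S|].
      now apply is_lim_seq_plus'. }
  (* Let l tend to infinity in a fixed partial sum; the resulting bound does not depend on N. *)
  assert (B : forall k, l2 (fun n => x k n - y n) /\ (nrm2 (fun n => (x k n - y n)%C) <= e k)%R).
  { intros k; apply ex_series_bounded; [intros; apply pow2_ge_0|].
    intros N; refine (is_lim_seq_le _ _ (Finite _) (Finite _) _ (LS k N) _).
    - intros l; eapply Rle_trans; [|apply (He k l)].
      apply (sum_n_le_Series (fun n => Cmod (x k n - x l n)%C ^ 2)%R);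
        [|intros; apply pow2_ge_0].
      now apply (l2_minus (x k) (x l)).
    - replace (Finite (e k)) with (Finite (e k + 0)) by (f_equal; ring).
      apply is_lim_seq_plus'; [apply is_lim_seq_const|exact Le]. }
  exists y; split.
  - apply l2_ext with (fun n => x O n - (x O n - y n)); [intros; ring|].
    apply l2_minus; [easy|apply B].
  - apply lim0_le with (2 := Le) (M := 1%R); intros k; rewrite Rmult_1_l.
    split; [apply nrm2_nonneg, B|apply B].
Qed.

(** The source term in the equation of q(z): J q(z) = z q(z) + e0. *)
Definition e0 : vect := fun n => match n with O => 1 | _ => 0 end.

Lemma sum_n_e0 (v : vect) (N : nat) : sum_n (fun m => e0 m * v m) N = v O :> C.
Proof.
  induction N as [|N IH]; [rewrite sum_O; simpl; ring|].
  rewrite csum_S, IH; simpl; ring.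
Qed.

Lemma rsum_e0 (u : vect) (N : nat) :
  sum_n (fun n => Cmod (e0 n * u n)%C) N = Cmod (u O) :> R.
Proof.
  induction N as [|N IH]; [rewrite sum_O; f_equal; simpl; ring|].
  rewrite rsum_S, IH; simpl; rewrite Cmult_0_l, Cmod_0; ring.
Qed.

Lemma CSeries_e0 (v : vect) : CSeries (fun n => e0 n * v n) = v O.
Proof.
  rewrite (CSeries_finite _ O); [rewrite sum_O; simpl; ring|].
  intros [|n] Hn; [lia|simpl; ring].
Qed.

Lemma summable_e0 (v : vect) : summable (fun n => e0 n * v n).
Proof. apply summable_finite with 1%nat; intros [|n] Hn; [lia|simpl; ring]. Qed.

Lemma l2_e0 : l2 e0.
Proof. apply l2_finite with 1%nat; intros [|n] Hn; [lia|easy]. Qed.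

(* For [w = p a b z] the sequences [f] below are exactly the range of [Jmin - z]. *)
Lemma kernel_dense (w h : vect) (eps : R) : (0 < eps)%R -> ~ l2 w -> l2 h ->
  exists f : vect, (exists N, forall n, (N <= n)%nat -> f n = 0) /\
    CSeries (fun m => w m * f m) = 0 /\ (nrm2 (fun n => (f n - h n)%C) <= eps)%R.
Proof.
  intros He Hw Hh.
  (* The error splits into the cut-off tail of h and a correction. Squaring the sum doubles each
     part, so each may cost eps / 4, with room to spare. *)
  assert (P : (0 < eps / 4)%R) by lra.
  pose proof (Series_tail_lim _ Hh) as Lt; apply is_lim_seq_spec in Lt.
  destruct (Lt (mkposreal _ P)) as [N HN]; simpl in HN; specialize (HN N (Nat.le_refl N)).
  rewrite Rminus_0_r in HN; apply Rabs_def2 in HN; destruct HN as [HN _].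
  set (s := sum_n (fun m => w m * h m) N : C).
  (* The correction will have squared norm |s|^2 / Q with Q the partial sum of |w|^2. As w is not in
     l2, Q can be made larger than 4 |s|^2 / eps. *)
  destruct (rsum_unbounded (fun n => Cmod (w n) ^ 2)%R (4 * Cmod s ^ 2 / eps)
    (fun n => pow2_ge_0 _) Hw) as [K HK].
  set (Q := sum_n _ K) in HK.
  assert (QP : (0 < Q)%R).
  { eapply Rle_lt_trans; [|exact HK].
    apply Rdiv_le_0_compat; [pose proof (pow2_ge_0 (Cmod s)); lra|easy]. }
  set (tr := fun (M : nat) (u : vect) => (fun n => if Nat.leb n M then u n else 0) : vect).
  assert (tr_in : forall M u n, (n <= M)%nat -> tr M u n = u n).
  { intros M u n H; unfold tr; now rewrite (proj2 (Nat.leb_le _ _)). }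
  assert (tr_out : forall M u n, (M < n)%nat -> tr M u n = 0).
  { intros M u n H; unfold tr; now rewrite (proj2 (Nat.leb_gt _ _)). }
  assert (tr_sum : forall M u, CSeries (fun m => w m * tr M u m) = sum_n (fun m => w m * u m) M).
  { intros M u; rewrite (CSeries_finite _ M).
    - apply csum_ext; intros n H; now rewrite tr_in.
    - intros n H; rewrite tr_out by easy; ring. }
  assert (tr_l2 : forall M u, l2 (tr M u)).
  { intros M u; apply l2_finite with (S M); intros n H; now apply tr_out. }
  set (wc := fun n => Cconj (w n)).
  (* The truncation of conj w pairs with w to Q, so this multiple cancels the sum s of the truncated
     h. *)
  set (c := - (s / RtoC Q)).
  assert (Q0 : RtoC Q <> 0) by (intros E; apply RtoC_inj in E; lra).
  assert (W : forall M u, summable (fun m => w m * tr M u m)).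
  { intros M u; apply summable_finite with (S M); intros n H; rewrite tr_out by easy; ring. }
  exists (fun n => tr N h n + c * tr K wc n); split; [|split].
  - exists (S (N + K)); intros n H; rewrite !tr_out by lia; ring.
  - rewrite (CSeries_ext _ (fun m => w m * tr N h m + c * (w m * tr K wc m)))
      by (intros; ring).
    rewrite CSeries_linear, !tr_sum by easy.
    rewrite (csum_ext (fun m => w m * wc m) (fun m => RtoC (Cmod (w m) ^ 2)))
      by (intros n _; now rewrite Cmod2_conj).
    rewrite csum_RtoC; fold Q s; unfold c; field; exact Q0.
  - rewrite (nrm2_ext _ (fun n => (tr N h n - h n) + c * tr K wc n)) by (intros; ring).
    assert (D1 : l2 (fun n => tr N h n - h n)) by now apply l2_minus.
    eapply Rle_trans; [apply l2_plus; [exact D1|now apply l2_scal]|].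
    rewrite nrm2_scal.
    assert (N1 : nrm2 (fun n => tr N h n - h n) = Series (fun k => (Cmod (h (S N + k)%nat) ^ 2)%R)).
    { rewrite <- (Series_truncate (fun k => Cmod (h k) ^ 2)%R).
      apply Series_ext; intros n; unfold tr; destruct (Nat.leb n N).
      - replace (h n - h n) with (RtoC 0) by ring; rewrite Cmod_0; ring.
      - replace (0 - h n) with (- h n) by ring; now rewrite Cmod_opp. }
    assert (N2 : nrm2 (tr K wc) = Q).
    { unfold nrm2; rewrite (Series_finite _ K).
      - apply sum_n_ext_loc; intros n H; rewrite tr_in by easy; unfold wc; now rewrite Cmod_conj.
      - intros n H; rewrite tr_out, Cmod_0 by easy; ring. }
    rewrite N1, N2; unfold c; rewrite Cmod_opp, Cmod_div, Cmod_R, Rabs_pos_eq by (easy || lra).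
    replace ((Cmod s / Q) ^ 2 * Q)%R with (Cmod s ^ 2 / Q)%R by (field; lra).
    assert (Cmod s ^ 2 / Q <= eps / 4)%R; [|simpl in *; lra].
    apply Rmult_le_reg_r with Q; [easy|].
    replace (Cmod s ^ 2 / Q * Q)%R with (Cmod s ^ 2)%R by (field; lra).
    apply Rmult_lt_compat_r with (r := eps) in HK; [|easy].
    replace (4 * Cmod s ^ 2 / eps * eps)%R with (4 * Cmod s ^ 2)%R in HK by (field; lra).
    lra.
Qed.

(** * The Jacobi recurrence *)

Lemma a_neq0 (a : nat -> R) (n : nat) : (forall n, 0 < a n)%R -> RtoC (a n) <> 0.
Proof. intros ha H; apply RtoC_inj in H; specialize (ha n); lra. Qed.

Lemma calJ_p (a b : nat -> R) (ha : forall n, (0 < a n)%R) (z : C) (n : nat) :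
  calJ a b (p a b z) n = z * p a b z n.
Proof.
  destruct n as [|n]; unfold p; simpl calJ.
  - simpl; field; now apply a_neq0.
  - apply (sol_pair_rec a b z _ _ n ha).
Qed.

Lemma calJ_q (a b : nat -> R) (ha : forall n, (0 < a n)%R) (z : C) (n : nat) :
  calJ a b (q a b z) n = z * q a b z n + e0 n.
Proof.
  destruct n as [|n]; unfold q; simpl calJ.
  - simpl; field; now apply a_neq0.
  - simpl e0; rewrite Cplus_0_r; apply (sol_pair_rec a b z _ _ n ha).
Qed.

Lemma calJ_linear (a b : nat -> R) (c : C) (u v : vect) (n : nat) :
  calJ a b (fun n => u n + c * v n) n = calJ a b u n + c * calJ a b v n.
Proof. destruct n; simpl; ring. Qed.

Lemma calJ_conj (a b : nat -> R) (u : vect) (n : nat) :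
  calJ a b (fun n => Cconj (u n)) n = Cconj (calJ a b u n).
Proof.
  assert (E : forall x : R, Cconj x = x).
  { intros x; unfold Cconj, RtoC; simpl; now rewrite Ropp_0. }
  destruct n; simpl; rewrite !Cplus_conj, !Cmult_conj, !E; ring.
Qed.

(** Row 0 of J determines u_1 from u_0, so the solutions form a line. Every uniqueness argument
    below ends here: two solutions with the same source differ by a multiple of p(z). *)
Lemma calJ_eigen (a b : nat -> R) (ha : forall n, (0 < a n)%R) (z : C) (u : vect) :
  (forall n, calJ a b u n = z * u n) -> forall n, u n = u O * p a b z n.
Proof.
  intros H n.
  enough (E : u n = u O * p a b z n /\ u (S n) = u O * p a b z (S n)) by apply E.
  induction n as [|n [IH1 IH2]].
  - split; [unfold p; simpl; ring|].
    specialize (H O); simpl in H; unfold p; simpl.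
    replace (u 1%nat) with ((z * u O - b O * u O) / a O); [field; now apply a_neq0|].
    rewrite <- H; field; now apply a_neq0.
  - split; [exact IH2|].
    pose proof (calJ_p a b ha z (S n)) as Hp; specialize (H (S n)); simpl calJ in H, Hp.
    assert (X : a (S n) * u (S (S n)) = a (S n) * (u O * p a b z (S (S n)))).
    { replace (a (S n) * u (S (S n))) with (z * u (S n) - a n * u n - b (S n) * u (S n))
        by (rewrite <- H; ring).
      replace (a (S n) * (u O * p a b z (S (S n)))) with
        (u O * (z * p a b z (S n) - a n * p a b z n - b (S n) * p a b z (S n)))
        by (rewrite <- Hp; ring).
      rewrite IH1, IH2; ring. }
    replace (u (S (S n))) with (a (S n) * u (S (S n)) / a (S n))
      by (field; now apply a_neq0).
    rewrite X; field; now apply a_neq0.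
Qed.

Lemma calJ_ext (a b : nat -> R) (u v : vect) :
  (forall n, u n = v n) -> forall n, calJ a b u n = calJ a b v n.
Proof. intros H [|n]; simpl; now rewrite !H. Qed.

Lemma calJ_finite (a b : nat -> R) (u : vect) (N : nat) :
  (forall n, (N <= n)%nat -> u n = 0) -> forall n, (S N <= n)%nat -> calJ a b u n = 0.
Proof. intros H [|n] Hn; [lia|]; simpl; rewrite !H by lia; ring. Qed.

(** The symmetric off-diagonal entries make the sum telescope, and row 0 has no left neighbour, so
    only the boundary term at N is left. *)
Lemma green (a b : nat -> R) (u v : vect) (N : nat) :
  sum_n (fun m => calJ a b u m * v m - u m * calJ a b v m) N =
  a N * (u (S N) * v N - u N * v (S N)) :> C.
Proof.
  induction N as [|N IH]; [rewrite sum_O; simpl; ring|].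
  rewrite csum_S, IH; simpl; ring.
Qed.

(** Green's identity for q(z) and p(z) at the same z: only the source [e0] contributes, and it picks
    out p_0 = 1. *)
Lemma wronskian (a b : nat -> R) (ha : forall n, (0 < a n)%R) (z : C) (n : nat) :
  a n * (q a b z (S n) * p a b z n - q a b z n * p a b z (S n)) = 1.
Proof.
  rewrite <- green with (b := b).
  transitivity (p a b z O : C); [|reflexivity].
  rewrite <- (sum_n_e0 (p a b z) n); apply csum_ext; intros m _.
  rewrite calJ_p, calJ_q by easy; ring.
Qed.

Lemma p_conj (a b : nat -> R) (ha : forall n, (0 < a n)%R) (z : C) (n : nat) :
  p a b (Cconj z) n = Cconj (p a b z n).
Proof.
  symmetry; rewrite (calJ_eigen a b ha (Cconj z) (fun n => Cconj (p a b z n))).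
  - unfold p at 1; simpl; unfold Cconj, RtoC, Cmult; simpl.
    destruct (p a b _ n) as [x y]; simpl; f_equal; ring.
  - intros m; now rewrite calJ_conj, calJ_p, Cmult_conj.
Qed.

Lemma p_0_conj (a b : nat -> R) (ha : forall n, (0 < a n)%R) (n : nat) :
  Cconj (p a b 0 n) = p a b 0 n.
Proof.
  rewrite <- p_conj by easy; f_equal; unfold Cconj, RtoC; simpl; now rewrite Ropp_0.
Qed.

(** The source [e0] is real, so q(0) minus its conjugate solves the homogeneous equation; it
    vanishes at index 0, hence everywhere. *)
Lemma q_0_conj (a b : nat -> R) (ha : forall n, (0 < a n)%R) (n : nat) :
  Cconj (q a b 0 n) = q a b 0 n.
Proof.
  assert (E : Cconj 0 = 0) by (unfold Cconj, RtoC; simpl; now rewrite Ropp_0).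
  assert (H := calJ_eigen a b ha 0 (fun n => q a b 0 n + (-(1)) * Cconj (q a b 0 n))).
  assert (X : q a b 0 n + (-(1)) * Cconj (q a b 0 n) = 0).
  { rewrite H.
    - unfold q at 1 2; simpl; rewrite E; ring.
    - intros m; rewrite calJ_linear, calJ_conj, calJ_q, Cplus_conj, Cmult_conj, E by easy.
      assert (Cconj (e0 m) = e0 m) as ->.
      { destruct m; unfold Cconj, RtoC; simpl; now rewrite Ropp_0. }
      ring. }
  replace (q a b 0 n) with ((q a b 0 n + - (1) * Cconj (q a b 0 n)) + Cconj (q a b 0 n)) at 2
    by ring.
  rewrite X; ring.
Qed.

(** Variation of constants: once all partial sums and tails are moved to a common index, the rows of
    p and q collect into z times [calR], and the remaining multiple of h_n is the Wronskian.
    Assuming convergence of the tail alone covers finitely supported h also when p(z) is not in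
    l2. *)
Lemma calJ_calR (a b : nat -> R) (ha : forall n, (0 < a n)%R) (z : C) (h : vect) :
  summable (fun m => q a b z m * h m) ->
  forall n, calJ a b (calR a b z h) n = z * calR a b z h n + h n.
Proof.
  intros Hs.
  set (S_ := fun n => sum_n (fun m => p a b z m * h m) n : C).
  set (T_ := fun n => CSeries (fun k => q a b z (n + 1 + k)%nat * h (n + 1 + k)%nat)).
  assert (ES : forall n, S_ (S n) = S_ n + p a b z (S n) * h (S n)) by
    (intros n; apply csum_S).
  assert (ET : forall n, T_ n = q a b z (S n) * h (S n) + T_ (S n)).
  { intros n; unfold T_.
    rewrite (CSeries_split _ 0), sum_O.
    - f_equal; [do 2 f_equal; lia|].
      apply CSeries_ext; intros k; do 2 f_equal; lia.
    - exact (summable_incr (fun m => q a b z m * h m) (n + 1) Hs). }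
  assert (ER : forall n, calR a b z h n = q a b z n * S_ n + p a b z n * T_ n) by
    reflexivity.
  intros [|n].
  - pose proof (calJ_p a b ha z 0) as Hp; pose proof (calJ_q a b ha z 0) as Hq.
    pose proof (wronskian a b ha z 0) as W.
    simpl calJ in *; simpl e0 in Hq; rewrite !ER, ES, (ET O).
    assert (S0 : S_ O = h O) by (unfold S_; rewrite sum_O; unfold p; simpl; ring).
    assert (q0 : q a b z O = 0) by reflexivity.
    assert (p0 : p a b z O = 1) by reflexivity.
    rewrite S0; rewrite q0, p0 in *.
    set (q1 := q a b z 1%nat) in *; set (p1 := p a b z 1%nat) in *.
    set (h1 := h 1%nat) in *; set (T1 := T_ 1%nat).
    (* In row 0 the Wronskian reduces to a_0 q_1 = 1, because q_0 = 0 and p_0 = 1. *)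
    transitivity (h O * (a O * q1) + (q1 * h1) * (b O * 1 + a O * p1) + T1 * (b O * 1 + a O * p1)
       ); [ring|].
    replace (a O * q1) with (RtoC 1) by (rewrite <- W; ring).
    rewrite Hp; ring.
  - pose proof (calJ_p a b ha z (S n)) as Hp; pose proof (calJ_q a b ha z (S n)) as Hq.
    pose proof (wronskian a b ha z n) as W.
    simpl calJ in *; simpl e0 in Hq; rewrite !ER, ES, (ET n), (ES (S n)), (ET (S n)).
    rewrite (ES n).
    set (qa := q a b z n) in *; set (qb := q a b z (S n)) in *;
      set (qc := q a b z (S (S n))) in *.
    set (pa := p a b z n) in *; set (pb := p a b z (S n)) in *;
      set (pc := p a b z (S (S n))) in *.
    set (hb := h (S n)); set (hc := h (S (S n))).
    transitivity ((a n * qa + b (S n) * qb + a (S n) * qc) * (S_ n + pb * hb) +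
      (a n * pa + b (S n) * pb + a (S n) * pc) * (qc * hc + T_ (S (S n))) +
      (a n * (qb * pa - qa * pb)) * hb); [ring|].
    rewrite Hp, Hq, W; ring.
Qed.

(** * The operator [calR] *)

Lemma calR_linear (a b : nat -> R) (z c : C) (h g : vect) (n : nat) :
  summable (fun m => q a b z m * h m) -> summable (fun m => q a b z m * g m) ->
  calR a b z (fun n => h n + c * g n) n = calR a b z h n + c * calR a b z g n.
Proof.
  intros Hh Hg; unfold calR.
  pose proof (summable_incr _ (n + 1) Hh) as Th.
  pose proof (summable_incr _ (n + 1) Hg) as Tg; cbv beta in Th, Tg.
  rewrite (CSeries_ext _ (fun k => q a b z (n + 1 + k)%nat * h (n + 1 + k)%nat +
    c * (q a b z (n + 1 + k)%nat * g (n + 1 + k)%nat))) by (intros; ring).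
  rewrite CSeries_linear by easy.
  rewrite (csum_ext (fun m => p a b z m * (h m + c * g m))
    (fun m => p a b z m * h m + c * (p a b z m * g m))) by (intros; ring).
  rewrite csum_linear; ring.
Qed.

(** Cauchy-Schwarz on the partial sum and on the tail. The constant is 10 = 2 + 8; the 8 is 2 times
    the square of the factor 2 in [Cmod_CSeries]. *)
Lemma calR_bound (a b : nat -> R) (z : C) (h : vect) :
  l2 (p a b z) -> l2 (q a b z) -> l2 h ->
  l2 (calR a b z h) /\
  (nrm2 (calR a b z h) <= 10 * nrm2 (p a b z) * nrm2 (q a b z) * nrm2 h)%R.
Proof.
  intros Hp Hq Hh.
  pose proof (l2_mul_summable _ _ Hp Hh) as Sp.
  pose proof (l2_mul_summable _ _ Hq Hh) as Sq.
  pose proof (Series_Cauchy_Schwarz _ _ Hp Hh) as CSp.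
  pose proof (Series_Cauchy_Schwarz _ _ Hq Hh) as CSq.
  set (A := Series (fun n => Cmod (p a b z n * h n))) in *.
  set (B := Series (fun n => Cmod (q a b z n * h n))) in *.
  assert (PT : forall n, (Cmod (calR a b z h n) ^ 2 <=
    2 * A ^ 2 * Cmod (q a b z n) ^ 2 + 8 * B ^ 2 * Cmod (p a b z n) ^ 2)%R).
  { intros n; unfold calR; eapply Rle_trans; [apply Cmod_sqr_plus|].
    rewrite !Cmod_mult, !Rpow_mult_distr.
    assert (HA : (Cmod (sum_n (fun m => (p a b z m * h m)%C) n) <= A)%R).
    { eapply Rle_trans; [apply Cmod_csum|].
      apply (sum_n_le_Series (fun m => Cmod (p a b z m * h m)%C) n Sp).
      intros; apply Cmod_ge_0. }
    assert (HB : (Cmod (CSeries (fun k => (q a b z (n + 1 + k)%nat * h (n + 1 + k)%nat)%C))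
      <= 2 * B)%R).
    { eapply Rle_trans.
      - apply Cmod_CSeries, (summable_incr (fun m => q a b z m * h m) (n + 1) Sq).
      - unfold B.
        rewrite (Series_incr_n (fun m => Cmod (q a b z m * h m)%C) (n + 1)) by (lia || easy).
        rewrite <- sum_n_Reals; set (s := sum_n _ _).
        assert (0 <= s)%R; [|simpl; lra].
        unfold s; generalize (Init.Nat.pred (n + 1)); clear; intros n.
        induction n as [|n IH]; [rewrite sum_O; apply Cmod_ge_0|].
        rewrite sum_Sn; unfold plus; simpl; pose proof (Cmod_ge_0 (q a b z (S n) * h (S n))); lra. }
    set (X := Cmod (sum_n _ n)) in *; set (Y := Cmod (CSeries _)) in *.
    assert (0 <= X)%R by apply Cmod_ge_0; assert (0 <= Y)%R by apply Cmod_ge_0.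
    assert (X ^ 2 <= A ^ 2)%R by (apply pow_incr; lra).
    assert (Y ^ 2 <= (2 * B) ^ 2)%R by (apply pow_incr; lra).
    pose proof (pow2_ge_0 (Cmod (q a b z n))); pose proof (pow2_ge_0 (Cmod (p a b z n))).
    nra. }
  assert (E : ex_series (fun n =>
    2 * A ^ 2 * Cmod (q a b z n) ^ 2 + 8 * B ^ 2 * Cmod (p a b z n) ^ 2)%R) by
    auto using ex_series_plus_R, ex_series_scal_R.
  split.
  - apply ex_series_le_R with (2 := E); intros n.
    rewrite Rabs_pos_eq by apply pow2_ge_0; apply PT.
  - apply Rle_trans with (2 * A ^ 2 * nrm2 (q a b z) + 8 * B ^ 2 * nrm2 (p a b z))%R.
    + unfold nrm2; rewrite <- !Series_scal_l, <- Series_plus by auto using ex_series_scal_R.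
      apply Series_le; [|exact E]; intros n; split; [apply pow2_ge_0|apply PT].
    + pose proof (nrm2_nonneg _ Hp); pose proof (nrm2_nonneg _ Hq).
      pose proof (Rmult_le_compat_r _ _ _ H0 CSp).
      pose proof (Rmult_le_compat_r _ _ _ H CSq). nra.
Qed.

(** Past the support of h the tail is empty and the partial sum is already the full sum, which
    vanishes. Orthogonality to p(z) is thus what brings [calR] into the domain of [Jmin]. *)
Lemma calR_finite (a b : nat -> R) (z : C) (h : vect) (N : nat) :
  (forall n, (N <= n)%nat -> h n = 0) -> CSeries (fun m => p a b z m * h m) = 0 ->
  forall n, (N <= n)%nat -> calR a b z h n = 0.
Proof.
  intros H0 H n Hn; unfold calR.
  rewrite CSeries_0 by (intros k; rewrite H0 by lia; ring).
  rewrite <- CSeries_finite, H; [ring|].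
  intros k Hk; rewrite H0 by lia; ring.
Qed.

Lemma clos_calR (a b : nat -> R) (ha : forall n, (0 < a n)%R) (z : C) (h : vect) :
  l2 (p a b z) -> l2 (q a b z) -> l2 h -> CSeries (fun m => p a b z m * h m) = 0 ->
  clos (Jmin a b) (calR a b z h) (calJ a b (calR a b z h)).
Proof.
  intros Hp Hq Hh H0.
  pose proof (l2_mul_summable _ _ Hp Hh) as Sp.
  pose proof (l2_mul_summable _ _ Hq Hh) as Sq.
  set (c := fun N => sum_n (fun m => p a b z m * h m) N : C).
  set (tail := fun N : nat => (fun n => if Nat.leb n N then 0 else h n) : vect).
  (* h - d is the truncation of h corrected by -c N e0. As p_0 = 1, it is exactly orthogonal to
     p(z), and c N tends to 0 because the full sum vanishes. *)
  set (d := fun N : nat => (fun n => tail N n + c N * e0 n) : vect).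
  set (hN := fun N : nat => (fun n => h n + (-(1)) * d N n) : vect).
  pose proof l2_e0 as He.
  assert (Hsq : forall n N, (Cmod (tail N n) ^ 2 = if Nat.leb n N then 0 else Cmod (h n) ^ 2)%R).
  { intros n N; unfold tail; destruct (Nat.leb n N); [rewrite Cmod_0; ring|easy]. }
  assert (Ht : forall N, l2 (tail N)).
  { intros N; apply ex_series_le_R with (2 := Hh); intros n; rewrite Hsq.
    pose proof (pow2_ge_0 (Cmod (h n))).
    destruct (Nat.leb n N); rewrite Rabs_pos_eq; lra. }
  assert (Hd : forall N, l2 (d N)) by (intros N; now apply l2_plus, l2_scal).
  assert (Ld : is_lim_seq (fun N => nrm2 (d N)) 0%R).
  { apply lim0_le with
      (fun N => Series (fun k => Cmod (h (S N + k)%nat) ^ 2) +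
                nrm2 e0 * (Cmod (c N) * Cmod (c N)))%R 2%R.
    - intros N; split; [now apply nrm2_nonneg|].
      eapply Rle_trans; [now apply l2_plus, l2_scal|].
      rewrite nrm2_scal; unfold nrm2 at 1.
      rewrite (Series_ext _ _ (fun n => Hsq n N)), Series_truncate; lra.
    - replace 0%R with (0 + nrm2 e0 * (0 * 0))%R by ring.
      apply is_lim_seq_plus'; [apply (Series_tail_lim _ Hh)|].
      apply is_lim_seq_mult'; [apply is_lim_seq_const|].
      assert (Lc : is_lim_seq (fun N => Cmod (c N)) 0%R).
      { apply is_lim_seq_ext with (2 := CSeries_tail_lim _ Sp); intros N.
        rewrite H0, <- Cmod_opp; f_equal; unfold c; ring. }
      now apply is_lim_seq_mult'. }
  assert (HhN : forall N, l2 (hN N)) by (intros N; now apply l2_plus, l2_scal).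
  assert (ER : forall N n,
    calR a b z (hN N) n - calR a b z h n = -(1) * calR a b z (d N) n).
  { intros N n; unfold hN; rewrite calR_linear; auto using l2_mul_summable; ring. }
  assert (EJ : forall N n, calJ a b (calR a b z (hN N)) n - calJ a b (calR a b z h) n =
    -(1) * calJ a b (calR a b z (d N)) n).
  { intros N n; rewrite !calJ_calR by auto using l2_mul_summable.
    replace (calR a b z (hN N) n) with (calR a b z h n + (-(1)) * calR a b z (d N) n)
      by (rewrite <- ER; ring).
    unfold hN; ring. }
  (* J calR g = z calR g + g, so J after [calR] is bounded as well, and convergence of [hN] to h
     yields convergence in the graph norm. *)
  assert (BR : forall g, l2 g -> l2 (calJ a b (calR a b z g)) /\
    (nrm2 (calJ a b (calR a b z g)) <= (20 * Cmod z ^ 2 *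
      nrm2 (p a b z) * nrm2 (q a b z) + 2) * nrm2 g)%R).
  { intros g Hg; destruct (calR_bound a b z g Hp Hq Hg) as [B1 B2].
    destruct (l2_plus _ _ (l2_scal z _ B1) Hg) as [B3 B4].
    assert (E : forall n, z * calR a b z g n + g n = calJ a b (calR a b z g) n).
    { intros n; rewrite calJ_calR; auto using l2_mul_summable. }
    split; [apply l2_ext with (1 := E) (2 := B3)|].
    rewrite <- (nrm2_ext _ _ E); eapply Rle_trans; [exact B4|].
    rewrite nrm2_scal; pose proof (pow2_ge_0 (Cmod z)); nra. }
  assert (M1 : Cmod (-(1)) = 1%R) by apply Cmod_m1.
  split; [now apply calR_bound|]; split; [now apply BR|].
  exists (fun N => calR a b z (hN N)), (fun N => calJ a b (calR a b z (hN N))).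
  split; [|split].
  - intros N; split; [|easy]; exists (S N); apply calR_finite.
    + intros n Hn; unfold hN, d, tail; rewrite (proj2 (Nat.leb_gt _ _)) by lia.
      destruct n; [lia|simpl; ring].
    + rewrite (CSeries_finite _ N).
      * rewrite (csum_ext _ (fun m => p a b z m * h m + (-(1)) * (c N * (e0 m * p a b z m)))).
        -- rewrite csum_linear, csum_scal, sum_n_e0; unfold c.
           change (p a b z 0%nat) with (RtoC 1); ring.
        -- intros n Hn; unfold hN, d, tail; rewrite (proj2 (Nat.leb_le _ _)) by lia; ring.
      * intros n Hn; unfold hN, d, tail; rewrite (proj2 (Nat.leb_gt _ _)) by lia.
        destruct n; [lia|simpl; ring].
  - apply l2norm_lim0.
    + intros N; apply l2_minus; now apply calR_bound.
    + apply lim0_le with (2 := Ld) (M := (10 * nrm2 (p a b z) * nrm2 (q a b z))%R).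
      intros N; split; [apply nrm2_nonneg, l2_minus; now apply calR_bound|].
      unfold vsub; rewrite (nrm2_ext _ _ (ER N)), nrm2_scal, M1, pow1, Rmult_1_l.
      now apply calR_bound.
  - apply l2norm_lim0.
    + intros N; apply l2_minus; now apply BR.
    + eapply lim0_le with (2 := Ld).
      intros N; split; [apply nrm2_nonneg, l2_minus; now apply BR|].
      unfold vsub; rewrite (nrm2_ext _ _ (EJ N)), nrm2_scal, M1, pow1, Rmult_1_l.
      now apply BR.
Qed.

(** * The boundary form *)

Definition dmax (a b : nat -> R) (u : vect) : Prop := l2 u /\ l2 (calJ a b u).

(* On [dmax] this is the limit of the Wronskians
   [a n * (u (S n) * v n - u n * v (S n))]. *)
Definition bform (a b : nat -> R) (u v : vect) : C :=
  CSeries (fun n => calJ a b u n * v n) - CSeries (fun n => u n * calJ a b v n).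

Lemma dmax_linear (a b : nat -> R) (c : C) (u v : vect) :
  dmax a b u -> dmax a b v -> dmax a b (fun n => u n + c * v n).
Proof.
  intros [Hu Hju] [Hv Hjv]; split.
  - now apply l2_plus, l2_scal.
  - apply l2_ext with (fun n => calJ a b u n + c * calJ a b v n).
    + intros n; now rewrite calJ_linear.
    + now apply l2_plus, l2_scal.
Qed.

Lemma dmax_conj (a b : nat -> R) (u : vect) :
  dmax a b u -> dmax a b (fun n => Cconj (u n)).
Proof.
  intros [Hu Hju]; split; [now apply l2_conj|].
  apply l2_ext with (fun n => Cconj (calJ a b u n)); [|now apply l2_conj].
  intros n; now rewrite calJ_conj.
Qed.

Lemma dmax_ext (a b : nat -> R) (u v : vect) :
  (forall n, u n = v n) -> dmax a b u -> dmax a b v.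
Proof.
  intros H [Hu Hju]; split; [now apply l2_ext with u|].
  apply l2_ext with (2 := Hju); now apply calJ_ext.
Qed.

Lemma bform_linear (a b : nat -> R) (c : C) (u v w : vect) :
  dmax a b u -> dmax a b v -> dmax a b w ->
  bform a b (fun n => u n + c * v n) w = bform a b u w + c * bform a b v w.
Proof.
  intros [Hu Hju] [Hv Hjv] [Hw Hjw]; unfold bform.
  rewrite (CSeries_ext _ (fun n => calJ a b u n * w n + c * (calJ a b v n * w n))) by
    (intros n; rewrite calJ_linear; ring).
  rewrite (CSeries_ext (fun n => (u n + c * v n) * calJ a b w n)
    (fun n => u n * calJ a b w n + c * (v n * calJ a b w n))) by (intros n; ring).
  rewrite !CSeries_linear by auto using l2_mul_summable; ring.
Qed.

Lemma bform_antisym (a b : nat -> R) (u v : vect) :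
  bform a b u v = - bform a b v u.
Proof.
  unfold bform.
  rewrite (CSeries_ext (fun n => calJ a b u n * v n) (fun n => v n * calJ a b u n)),
    (CSeries_ext (fun n => u n * calJ a b v n) (fun n => calJ a b v n * u n))
    by (intros; ring).
  ring.
Qed.

Lemma bform_diag (a b : nat -> R) (u : vect) : bform a b u u = 0.
Proof.
  unfold bform.
  rewrite (CSeries_ext (fun n => u n * calJ a b u n) (fun n => calJ a b u n * u n))
    by (intros; ring).
  ring.
Qed.

Lemma bform_conj (a b : nat -> R) (u v : vect) :
  bform a b (fun n => Cconj (u n)) (fun n => Cconj (v n)) = Cconj (bform a b u v).
Proof.
  unfold bform; rewrite Cminus_conj, <- !CSeries_conj.
  f_equal; apply CSeries_ext; intros n; now rewrite calJ_conj, Cmult_conj.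
Qed.

Lemma bform_ext (a b : nat -> R) (u u' v v' : vect) :
  (forall n, u n = u' n) -> (forall n, v n = v' n) -> bform a b u v = bform a b u' v'.
Proof.
  intros H H'; unfold bform; f_equal; apply CSeries_ext; intros n;
    now rewrite ?H, ?H', ?(calJ_ext a b u u' H), ?(calJ_ext a b v v' H').
Qed.

Lemma Jmin_l2 (a b : nat -> R) (u v : vect) : Jmin a b u v -> l2 u /\ l2 v.
Proof.
  intros [[N HN] ->]; split; [now apply l2_finite with N|].
  apply l2_finite with (S N); now apply calJ_finite.
Qed.

(** A row of J involves at most three entries, so coordinatewise convergence of the approximants
    already identifies the limit. *)
Lemma clos_Jmin_calJ (a b : nat -> R) (u v : vect) :
  clos (Jmin a b) u v -> v = calJ a b u.
Proof.
  intros [Hu [Hv [x [y [Hxy [Hx Hy]]]]]].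
  assert (Lx : forall n, is_lim_seq (fun k => Cmod (x k n - u n)) 0%R).
  { intros n; apply l2_lim_pointwise; auto; intros k; apply (Jmin_l2 a b _ _ (Hxy k)). }
  assert (Ly : forall n, is_lim_seq (fun k => Cmod (y k n - v n)) 0%R).
  { intros n; apply l2_lim_pointwise; auto; intros k; apply (Jmin_l2 a b _ _ (Hxy k)). }
  assert (Lin : forall (k n : nat), calJ a b (fun n => u n + (-(1)) * x k n) n =
    calJ a b u n - y k n).
  { intros k n; rewrite calJ_linear; destruct (Hxy k) as [_ ->]; ring. }
  assert (LJ : forall n, is_lim_seq
    (fun k => Cmod (calJ a b (fun n => u n + (-(1)) * x k n) n)) 0%R).
  { assert (Hterm : forall (c : R) n,
      is_lim_seq (fun k => Cmod c * Cmod (x k n - u n))%R 0%R).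
    { intros c n; replace 0%R with (Cmod c * 0)%R by ring.
      apply is_lim_seq_mult'; [apply is_lim_seq_const|apply Lx]. }
    assert (E : forall k n, Cmod (u n + (-(1)) * x k n) = Cmod (x k n - u n)).
    { intros k n; rewrite <- Cmod_opp; f_equal; ring. }
    intros [|n]; simpl.
    - apply lim0_le with (M := 1%R) (y := fun k => (Cmod (b O) * Cmod (x k O - u O) +
        Cmod (a O) * Cmod (x k 1%nat - u 1%nat))%R).
      + intros k; split; [apply Cmod_ge_0|]; rewrite Rmult_1_l, <- !E, <- !Cmod_mult.
        apply Cmod_triangle.
      + replace 0%R with (0 + 0)%R by ring; now apply is_lim_seq_plus'.
    - apply lim0_le with (M := 1%R) (y := fun k => (Cmod (a n) * Cmod (x k n - u n) +
        Cmod (b (S n)) * Cmod (x k (S n) - u (S n)) +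
        Cmod (a (S n)) * Cmod (x k (S (S n)) - u (S (S n))))%R).
      + intros k; split; [apply Cmod_ge_0|]; rewrite Rmult_1_l, <- !E, <- !Cmod_mult.
        eapply Rle_trans; [apply Cmod_triangle|]; apply Rplus_le_compat_r, Cmod_triangle.
      + replace 0%R with (0 + 0 + 0)%R by ring; apply is_lim_seq_plus'; [|easy].
        now apply is_lim_seq_plus'. }
  apply functional_extensionality; intros n.
  enough (E : v n - calJ a b u n = 0).
  { replace (v n) with ((v n - calJ a b u n) + calJ a b u n) by ring; rewrite E; ring. }
  apply Cmod_le0.
  eapply lim0_unique; [|replace 0%R with (0 + 0)%R by ring;
    exact (is_lim_seq_plus' _ _ _ _ (Ly n) (LJ n))].
  intros k; cbv beta; rewrite Lin, <- (Cmod_opp (y k n - v n)),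
    <- (Cmod_opp (calJ a b u n - y k n)).
  eapply Rle_trans; [|apply Cmod_triangle].
  right; f_equal; ring.
Qed.

Lemma bform_Jmin (a b : nat -> R) (u v : vect) (N : nat) :
  (forall n, (N <= n)%nat -> u n = 0) -> bform a b u v = 0.
Proof.
  intros H; unfold bform.
  rewrite (CSeries_finite (fun n => calJ a b u n * v n) N), (CSeries_finite _ N).
  - transitivity (sum_n (fun n => calJ a b u n * v n + (-(1)) * (u n * calJ a b v n)) N : C).
    + rewrite csum_linear; ring.
    + rewrite (csum_ext _ (fun m => calJ a b u m * v m - u m * calJ a b v m))
        by (intros; ring).
      rewrite green, !H by lia; ring.
  - intros n Hn; rewrite H by lia; ring.
  - intros n Hn; rewrite (calJ_finite a b u N) by (easy || lia); ring.
Qed.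

Lemma clos_Jmin_dmax (a b : nat -> R) (u : vect) :
  dom (clos (Jmin a b)) u -> dmax a b u.
Proof.
  intros [v H]; pose proof (clos_Jmin_calJ a b u v H) as ->.
  destruct H as [Hu [Hv _]]; now split.
Qed.

(** B vanishes on finitely supported sequences by Green's identity and is continuous in the graph
    norm. *)
Lemma bform_clos (a b : nat -> R) (u v : vect) :
  dom (clos (Jmin a b)) u -> dmax a b v -> bform a b u v = 0.
Proof.
  intros [f H] [Hv Hjv]; pose proof (clos_Jmin_calJ a b u f H) as ->.
  destruct H as [Hu [Hju [x [y [Hxy [Hx Hy]]]]]].
  assert (Lx : forall k, l2 (x k)) by (intros k; apply (Jmin_l2 a b _ _ (Hxy k))).
  assert (Ly : forall k, l2 (y k)) by (intros k; apply (Jmin_l2 a b _ _ (Hxy k))).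
  apply l2norm_lim0 in Hx; [|intros k; now apply l2_minus].
  apply l2norm_lim0 in Hy; [|intros k; now apply l2_minus].
  enough (Cmod (bform a b u v) ^ 2 <= 0)%R.
  { apply Cmod_le0; pose proof (Cmod_ge_0 (bform a b u v)); nra. }
  (* The constant 8 is 2 from squaring a sum of two terms times 4 from [Cmod_CSeries_mul]. *)
  pose proof (is_lim_seq_plus' _ _ _ _
    (is_lim_seq_mult' _ _ _ _ (is_lim_seq_const (8 * nrm2 v)) Hy)
    (is_lim_seq_mult' _ _ _ _ (is_lim_seq_const (8 * nrm2 (calJ a b v))) Hx)) as L.
  rewrite !Rmult_0_r, Rplus_0_r in L; refine (lim0_unique _ _ _ L); intros k.
  destruct (Hxy k) as [[N HN] Ek].
  assert (E : bform a b u v =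
    CSeries (fun n => vsub (x k) u n * calJ a b v n) +
    -(1) * CSeries (fun n => vsub (y k) (calJ a b u) n * v n)).
  { transitivity (bform a b u v + -(1) * bform a b (x k) v).
    - rewrite (bform_Jmin a b (x k) v N HN); ring.
    - unfold bform, vsub; rewrite <- Ek.
      rewrite (CSeries_ext (fun n => (x k n - u n) * calJ a b v n)
        (fun n => x k n * calJ a b v n + -(1) * (u n * calJ a b v n))) by (intros; ring).
      rewrite (CSeries_ext (fun n => (y k n - calJ a b u n) * v n)
        (fun n => y k n * v n + -(1) * (calJ a b u n * v n))) by (intros; ring).
      rewrite !CSeries_linear by auto using l2_mul_summable; ring. }
  assert (l2 (vsub (x k) u)) as D1 by now apply l2_minus.
  assert (l2 (vsub (y k) (calJ a b u))) as D2 by now apply l2_minus.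
  rewrite E; eapply Rle_trans; [apply Cmod_sqr_plus|].
  rewrite Cmod_mult, Cmod_m1.
  pose proof (Cmod_CSeries_mul _ _ D1 Hjv); pose proof (Cmod_CSeries_mul _ _ D2 Hv).
  cbv beta in *; lra.
Qed.

(** * Boundary values of p(z) and q(z), and the domain of the closure *)

Lemma dmax_source (a b : nat -> R) (z : C) (u h : vect) : l2 u -> l2 h ->
  (forall n, calJ a b u n = z * u n + h n) -> dmax a b u.
Proof.
  intros Hu Hh H; split; [easy|].
  apply l2_ext with (fun n => z * u n + h n); [easy|].
  apply l2_plus; [|easy]; now apply l2_scal.
Qed.

Lemma dmax_p (a b : nat -> R) (ha : forall n, (0 < a n)%R) (z : C) :
  l2 (p a b z) -> dmax a b (p a b z).
Proof.
  intros H; apply dmax_source with z (fun n => 0 * e0 n); [easy|apply l2_scal, l2_e0|].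
  intros n; rewrite calJ_p by easy; ring.
Qed.

Lemma dmax_q (a b : nat -> R) (ha : forall n, (0 < a n)%R) (z : C) :
  l2 (q a b z) -> dmax a b (q a b z).
Proof.
  intros H; apply dmax_source with z e0; [easy|apply l2_e0|now apply calJ_q].
Qed.

(** Source coefficient 0 stands for p and 1 for q, so all the forms that enter [gamma] are instances
    of this identity. *)
Lemma bform_source (a b : nat -> R) (z w : C) (c d : C) (u v : vect) :
  l2 u -> l2 v ->
  (forall n, calJ a b u n = z * u n + c * e0 n) ->
  (forall n, calJ a b v n = w * v n + d * e0 n) ->
  bform a b u v = (z - w) * CSeries (fun n => u n * v n) + c * v O - d * u O.
Proof.
  intros Hu Hv Ju Jv; unfold bform.
  rewrite (CSeries_ext (fun n => calJ a b u n * v n)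
    (fun n => z * (u n * v n) + c * (e0 n * v n))) by (intros; rewrite Ju; ring).
  rewrite (CSeries_ext (fun n => u n * calJ a b v n)
    (fun n => w * (u n * v n) + d * (e0 n * u n))) by (intros; rewrite Jv; ring).
  rewrite !CSeries_linear, !CSeries_scal, !CSeries_e0
    by auto using l2_mul_summable, summable_scal, summable_e0.
  ring.
Qed.

Lemma inner_real (u v : vect) : (forall n, Cconj (v n) = v n) ->
  inner u v = CSeries (fun n => u n * v n).
Proof. intros H; apply CSeries_ext; intros n; now rewrite H. Qed.

Lemma calJ_p_source (a b : nat -> R) (ha : forall n, (0 < a n)%R) (z : C) (n : nat) :
  calJ a b (p a b z) n = z * p a b z n + 0 * e0 n.
Proof. rewrite calJ_p by easy; ring. Qed.

Lemma calJ_q_source (a b : nat -> R) (ha : forall n, (0 < a n)%R) (z : C) (n : nat) :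
  calJ a b (q a b z) n = z * q a b z n + 1 * e0 n.
Proof. rewrite calJ_q by easy; ring. Qed.

Lemma bform_p_p0 (a b : nat -> R) (ha : forall n, (0 < a n)%R) (z : C) :
  l2 (p a b z) -> l2 (p a b 0) ->
  bform a b (p a b z) (p a b 0) = z * inner (p a b z) (p a b 0).
Proof.
  intros H H0; rewrite (bform_source a b z 0 0 0), inner_real;
    auto using calJ_p_source, p_0_conj; ring.
Qed.

Lemma bform_p_q0 (a b : nat -> R) (ha : forall n, (0 < a n)%R) (z : C) :
  l2 (p a b z) -> l2 (q a b 0) ->
  bform a b (p a b z) (q a b 0) = z * inner (p a b z) (q a b 0) - 1.
Proof.
  intros H H0; rewrite (bform_source a b z 0 0 1), inner_real;
    auto using calJ_p_source, calJ_q_source, q_0_conj.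
  change (p a b z 0%nat) with (RtoC 1); ring.
Qed.

Lemma bform_q_p0 (a b : nat -> R) (ha : forall n, (0 < a n)%R) (z : C) :
  l2 (q a b z) -> l2 (p a b 0) ->
  bform a b (q a b z) (p a b 0) = 1 + z * inner (q a b z) (p a b 0).
Proof.
  intros H H0; rewrite (bform_source a b z 0 1 0), inner_real;
    auto using calJ_p_source, calJ_q_source, p_0_conj.
  change (p a b 0 0%nat) with (RtoC 1); ring.
Qed.

Lemma bform_q_q0 (a b : nat -> R) (ha : forall n, (0 < a n)%R) (z : C) :
  l2 (q a b z) -> l2 (q a b 0) ->
  bform a b (q a b z) (q a b 0) = z * inner (q a b z) (q a b 0).
Proof.
  intros H H0; rewrite (bform_source a b z 0 1 1), inner_real;
    auto using calJ_q_source, q_0_conj.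
  change (q a b 0 0%nat) with (RtoC 0); change (q a b z 0%nat) with (RtoC 0); ring.
Qed.

Lemma bform_q0_p0 (a b : nat -> R) (ha : forall n, (0 < a n)%R) :
  l2 (p a b 0) -> l2 (q a b 0) -> bform a b (q a b 0) (p a b 0) = 1.
Proof. intros Hp Hq; rewrite bform_q_p0 by easy; ring. Qed.

Lemma bform_linear_r (a b : nat -> R) (c : C) (u v w : vect) :
  dmax a b u -> dmax a b v -> dmax a b w ->
  bform a b w (fun n => u n + c * v n) = bform a b w u + c * bform a b w v.
Proof.
  intros Hu Hv Hw.
  rewrite bform_antisym, bform_linear, (bform_antisym a b w u), (bform_antisym a b w v)
    by easy; ring.
Qed.

(** As J p(0) = 0, the first condition says that f = Ju is orthogonal to p(0), so w = calR(0) f lies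
    in the domain of the closure and Jw = f. Then u - w is a multiple of p(0), which the second
    condition excludes because B(p(0), q(0)) = -1. *)
Lemma dom_clos_Jmin (a b : nat -> R) (ha : forall n, (0 < a n)%R) (u : vect) :
  l2 (p a b 0) -> l2 (q a b 0) -> dmax a b u ->
  bform a b u (p a b 0) = 0 -> bform a b u (q a b 0) = 0 ->
  dom (clos (Jmin a b)) u.
Proof.
  intros Hp Hq Hu Bp Bq.
  pose proof (dmax_p a b ha 0 Hp) as Dp; pose proof (dmax_q a b ha 0 Hq) as Dq.
  set (f := calJ a b u).
  assert (Hf : CSeries (fun m => p a b 0 m * f m) = 0).
  { transitivity (bform a b u (p a b 0)); [|exact Bp]; unfold bform, f.
    rewrite (CSeries_0 (fun n => u n * calJ a b (p a b 0) n))
      by (intros n; rewrite calJ_p by easy; ring).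
    rewrite (CSeries_ext _ (fun n => calJ a b u n * p a b 0 n)) by (intros; ring); ring. }
  pose proof (clos_calR a b ha 0 f Hp Hq (proj2 Hu) Hf) as Hc.
  set (w := calR a b 0 f) in *.
  assert (Dw : dom (clos (Jmin a b)) w) by (eexists; exact Hc).
  pose proof (clos_Jmin_dmax a b w Dw) as Mw.
  assert (Jw : forall n, calJ a b w n = f n).
  { intros n; unfold w; rewrite calJ_calR; [ring|easy|].
    apply l2_mul_summable; [easy|apply Hu]. }
  set (d := fun n => u n + (-(1)) * w n).
  assert (Ed : forall n, d n = d O * p a b 0 n).
  { apply (calJ_eigen a b ha 0); intros n; unfold d at 1.
    rewrite calJ_linear, Jw; unfold f; ring. }
  assert (d0 : d O = 0).
  { assert (Bd : bform a b d (q a b 0) = 0).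
    { unfold d; rewrite bform_linear, Bq, (bform_clos a b w) by easy; ring. }
    (* [bform_linear] treats sums u + c v, so the multiple of p(0) is given a zero first summand. *)
    rewrite (bform_ext a b d (fun n => (fun n => 0 * p a b 0 n) n + d O * p a b 0 n)
      _ (q a b 0)) in Bd by (easy || (intros n; rewrite (Ed n) at 1; ring)).
    assert (Dz : dmax a b (fun n => 0 * p a b 0 n)).
    { apply dmax_ext with (fun n => p a b 0 n + -(1) * p a b 0 n); [intros; ring|].
      now apply dmax_linear. }
    rewrite bform_linear in Bd by easy.
    assert (bform a b (fun n => 0 * p a b 0 n) (q a b 0) = 0) as Z.
    { rewrite (bform_ext a b _ (fun n => p a b 0 n + -(1) * p a b 0 n) _ (q a b 0))
        by (easy || (intros; ring)).
      rewrite bform_linear by easy; ring. }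
    rewrite Z, bform_antisym, bform_q0_p0 in Bd by easy.
    replace (d O) with (- (0 + d O * - (1))) by ring; rewrite Bd; ring. }
  replace u with w; [exact Dw|].
  apply functional_extensionality; intros n.
  replace (w n) with (u n - d n) by (unfold d; ring).
  rewrite Ed, d0; ring.
Qed.

(** * The boundary condition that defines the domain of [Jt] *)

Lemma dmax_bvec (a b : nat -> R) (ha : forall n, (0 < a n)%R) (t : option R) :
  l2 (p a b 0) -> l2 (q a b 0) -> dmax a b (bvec a b t).
Proof.
  intros Hp Hq; pose proof (dmax_p a b ha 0 Hp); pose proof (dmax_q a b ha 0 Hq).
  destruct t as [t|]; [|easy].
  apply dmax_ext with (fun n => q a b 0 n + t * p a b 0 n);
    [intros; unfold bvec, vadd, vscal; ring|now apply dmax_linear].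
Qed.

Lemma bform_bvec_Some (a b : nat -> R) (ha : forall n, (0 < a n)%R) (t : R) (u : vect) :
  l2 (p a b 0) -> l2 (q a b 0) -> dmax a b u ->
  bform a b u (bvec a b (Some t)) = bform a b u (q a b 0) + t * bform a b u (p a b 0).
Proof.
  intros Hp Hq Hu; pose proof (dmax_p a b ha 0 Hp); pose proof (dmax_q a b ha 0 Hq).
  rewrite <- bform_linear_r by easy; apply bform_ext; [easy|].
  intros; unfold bvec, vadd, vscal; ring.
Qed.

Lemma bvec_conj (a b : nat -> R) (ha : forall n, (0 < a n)%R) (t : option R) (n : nat) :
  Cconj (bvec a b t n) = bvec a b t n.
Proof.
  destruct t as [t|]; simpl; [|now apply p_0_conj].
  unfold vadd, vscal; rewrite Cplus_conj, Cmult_conj, p_0_conj, q_0_conj by easy.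
  do 2 f_equal; unfold Cconj, RtoC; simpl; now rewrite Ropp_0.
Qed.

(* [bvec a b t] and [w] form a symplectic basis of D(Jmax) / D(clos Jmin). *)
Lemma bvec_dual (a b : nat -> R) (ha : forall n, (0 < a n)%R) (t : option R) :
  l2 (p a b 0) -> l2 (q a b 0) ->
  exists w, dmax a b w /\ bform a b (bvec a b t) w = 1 /\
    forall u, dmax a b u -> bform a b u (bvec a b t) = 0 -> bform a b u w = 0 ->
      dom (clos (Jmin a b)) u.
Proof.
  intros Hp Hq; pose proof (dmax_p a b ha 0 Hp); pose proof (dmax_q a b ha 0 Hq).
  pose proof (bform_q0_p0 a b ha Hp Hq) as B.
  destruct t as [t|].
  - exists (p a b 0); split; [easy|split].
    + rewrite bform_antisym, bform_bvec_Some, bform_diag, bform_antisym, B by easy; ring.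
    + intros u Hu H1 H2; apply dom_clos_Jmin; auto.
      rewrite bform_bvec_Some, H2 in H1 by easy.
      rewrite Cmult_0_r, Cplus_0_r in H1; exact H1.
  (* -q(0) would serve too; the added p(0) is invisible to B(p(0), .) and gives the shape required
     by [dmax_linear]. *)
  - exists (fun n => p a b 0 n + -(1) * q a b 0 n); split; [now apply dmax_linear|split].
    + simpl; rewrite bform_linear_r, bform_diag, bform_antisym, B by easy; ring.
    + simpl; intros u Hu H1 H2; apply dom_clos_Jmin; auto.
      rewrite bform_linear_r, H1 in H2 by easy.
      transitivity (- (0 + -(1) * bform a b u (q a b 0))); [ring|rewrite H2; ring].
Qed.

(** Replaces the direct sum by a single linear equation, which can be tested on explicit vectors. *)
Lemma Jt_iff (a b : nat -> R) (ha : forall n, (0 < a n)%R) (t : option R) (u v : vect) :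
  l2 (p a b 0) -> l2 (q a b 0) ->
  Jt a b t u v <-> (dmax a b u /\ bform a b u (bvec a b t) = 0) /\ v = calJ a b u.
Proof.
  intros Hp Hq; pose proof (dmax_bvec a b ha t Hp Hq) as Db.
  destruct (bvec_dual a b ha t Hp Hq) as [w [Dw [Bw Hw]]].
  unfold Jt; set (be := bvec a b t) in *; clearbody be.
  split; intros [H ->]; (split; [|easy]).
  - destruct H as [[d y] [[H1 [[c Hc] H3]] _]]; simpl in *; subst y u.
    pose proof (clos_Jmin_dmax a b d H1) as Dd.
    split; [now apply dmax_linear|].
    unfold vadd, vscal; rewrite bform_linear, bform_diag, bform_clos by easy; ring.
  (* Pairing with w reads off the coefficient of beta: B(beta, w) = 1, and B(., w) vanishes on the
     domain of the closure. This gives the decomposition and its uniqueness. *)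
  - destruct H as [Du Bu]; set (c := bform a b u w).
    exists (vadd u (vscal (- c) be), vscal c be); split; simpl.
    + split; [|split].
      * apply Hw; unfold vadd, vscal; [now apply dmax_linear| |];
          rewrite bform_linear by easy.
        -- rewrite Bu, bform_diag; ring.
        -- rewrite Bw; unfold c; ring.
      * now exists c.
      * apply functional_extensionality; intros n; unfold vadd, vscal; ring.
    + intros [d y] [H1 [[c' Hc] H3]]; simpl in *.
      pose proof (clos_Jmin_dmax a b d H1) as Dd.
      assert (E : c = c').
      { unfold c; rewrite H3, Hc; unfold vadd, vscal.
        rewrite bform_linear, Bw, bform_clos by easy; ring. }
      rewrite <- E in Hc; f_equal; [|now symmetry].
      apply functional_extensionality; intros n; rewrite H3, Hc.
      unfold vadd, vscal; ring.
Qed.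

(** Since p_0 = 1, h - s e0 is orthogonal to p(z), so its image lies in the domain of the closure
    and B ignores it. What remains is s calR(z) e0 = s q(z). *)
Lemma bform_calR (a b : nat -> R) (ha : forall n, (0 < a n)%R) (z : C) (h v : vect) :
  l2 (p a b z) -> l2 (q a b z) -> l2 h -> dmax a b v ->
  bform a b (calR a b z h) v =
  CSeries (fun m => p a b z m * h m) * bform a b (q a b z) v.
Proof.
  intros Hp Hq Hh Hv; set (s := CSeries _).
  set (g := fun n => h n + - s * e0 n).
  assert (Hg : l2 g) by (apply l2_plus, l2_scal, l2_e0; exact Hh).
  assert (Sg : CSeries (fun m => p a b z m * g m) = 0).
  { rewrite (CSeries_ext _ (fun m => p a b z m * h m + - s * (e0 m * p a b z m)))
      by (intros; unfold g; ring).
    rewrite CSeries_linear, CSeries_e0 by auto using l2_mul_summable, summable_e0.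
    change (p a b z 0%nat) with (RtoC 1); fold s; ring. }
  assert (Dg : dom (clos (Jmin a b)) (calR a b z g)) by
    (eexists; apply clos_calR; eassumption).
  assert (E : forall n, calR a b z h n = calR a b z g n + s * q a b z n).
  { intros n; unfold g; rewrite calR_linear by auto using l2_mul_summable, l2_e0.
    assert (calR a b z e0 n = q a b z n) as ->; [|ring].
    unfold calR; rewrite CSeries_0
      by (intros k; replace (n + 1 + k)%nat with (S (n + k)) by lia; simpl; ring).
    rewrite (csum_ext _ (fun m => e0 m * p a b z m)) by (intros; ring).
    rewrite sum_n_e0; change (p a b z 0%nat) with (RtoC 1); ring. }
  rewrite (bform_ext a b _ _ v v E) by easy.
  rewrite bform_linear, bform_clos by auto using clos_Jmin_dmax, dmax_q; ring.
Qed.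

Lemma Cminus_conj_neq0 (z : C) : Im z <> 0%R -> z - Cconj z <> 0.
Proof.
  destruct z as [x y]; simpl; intros H E.
  apply (f_equal Im) in E; simpl in E; lra.
Qed.

(* A zero of this form would make [p a b z] an eigenvector of the symmetric
   operator [Jt] with the non-real eigenvalue [z]. *)
Lemma bform_p_bvec_neq0 (a b : nat -> R) (ha : forall n, (0 < a n)%R) (t : option R)
    (z : C) : Im z <> 0%R -> l2 (p a b 0) -> l2 (q a b 0) -> l2 (p a b z) ->
  bform a b (p a b z) (bvec a b t) <> 0.
Proof.
  intros hz Hp0 Hq0 Hp B.
  pose proof (dmax_bvec a b ha t Hp0 Hq0) as Db.
  destruct (bvec_dual a b ha t Hp0 Hq0) as [w [Dw [Bw Hw]]].
  set (c := bform a b (p a b z) w).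
  pose proof (dmax_p a b ha z Hp) as Dp.
  pose proof (dmax_conj a b _ Dp) as Dpc.
  assert (Dd : dom (clos (Jmin a b)) (fun n => p a b z n + - c * bvec a b t n)).
  { apply Hw; [now apply dmax_linear| |]; rewrite bform_linear by easy.
    - rewrite B, bform_diag; ring.
    - rewrite Bw; unfold c; ring. }
  set (pc := fun n => Cconj (p a b z n)) in *.
  assert (Z : bform a b (p a b z) pc = 0).
  { pose proof (bform_clos a b _ pc Dd Dpc) as E.
    rewrite bform_linear in E by easy.
    (* beta is real, so this is the conjugate of B(beta, p(z)), which vanishes by assumption. *)
    assert (X : bform a b (bvec a b t) pc = 0).
    { rewrite (bform_ext a b _ (fun n => Cconj (bvec a b t n)) pc pc)
        by (easy || (intros; now rewrite bvec_conj)).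
      unfold pc; rewrite bform_conj, bform_antisym, B.
      unfold Cconj, RtoC, Copp; simpl; f_equal; ring. }
    rewrite X in E; rewrite <- E; ring. }
  (* The conjugate of p(z) solves the equation at conj z, so Z becomes (z - conj z) times the
     squared norm of p(z), and p_0 = 1 keeps that norm positive. *)
  rewrite (bform_source a b z (Cconj z) 0 0) in Z; [|easy|apply Dpc| |].
  - assert (N : CSeries (fun n => p a b z n * pc n) = RtoC (nrm2 (p a b z))).
    { unfold CSeries, RtoC, nrm2; f_equal.
      - apply Series_ext; intros n; unfold pc; now rewrite <- Cmod2_conj.
      - transitivity (Im (CSeries (fun _ => 0))); [|now rewrite CSeries_0].
        apply Series_ext; intros n; unfold pc; now rewrite <- Cmod2_conj. }
    rewrite N in Z.
    apply (Cmult_neq_0 (z - Cconj z) (RtoC (nrm2 (p a b z)))).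
    + now apply Cminus_conj_neq0.
    + intros E; apply RtoC_inj in E.
      pose proof (Cmod_le_nrm2 _ O Hp) as H; change (p a b z 0%nat) with (RtoC 1) in H.
      rewrite E, Cmod_1 in H; lra.
    + rewrite <- Z; ring.
  - intros n; now apply calJ_p_source.
  - intros n; unfold pc; rewrite calJ_conj, calJ_p, Cmult_conj by easy; ring.
Qed.

(** * The resolvent *)

(** The denominator is -B(p(z), beta) for real t and B(p(z), beta) for t infinite. *)
Lemma gamma_den_neq0 (a b : nat -> R) (ha : forall n, (0 < a n)%R) (t : option R)
    (z : C) : l2 (p a b 0) -> l2 (q a b 0) -> l2 (p a b z) ->
  bform a b (p a b z) (bvec a b t) <> 0 -> gamma_den a b z t <> 0.
Proof.
  intros Hp0 Hq0 Hp B H; apply B; pose proof (dmax_p a b ha z Hp).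
  destruct t as [t|]; simpl in H.
  - rewrite bform_bvec_Some, bform_p_p0, bform_p_q0 by easy.
    match type of H with ?d = _ => transitivity (- d); [ring|rewrite H; ring] end.
  - simpl; now rewrite bform_p_p0.
Qed.

(** This equation is the boundary condition for gamma p(z) + q(z); by [bform_calR] it is also the
    one for the claimed resolvent, up to the factor <h, p(conj z)>. *)
Lemma gamma_spec (a b : nat -> R) (ha : forall n, (0 < a n)%R) (t : option R)
    (z : C) : l2 (p a b 0) -> l2 (q a b 0) -> l2 (p a b z) -> l2 (q a b z) ->
  gamma_den a b z t <> 0 ->
  gamma a b z t * bform a b (p a b z) (bvec a b t) + bform a b (q a b z) (bvec a b t) = 0.
Proof.
  intros Hp0 Hq0 Hp Hq H.
  pose proof (dmax_p a b ha z Hp); pose proof (dmax_q a b ha z Hq).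
  destruct t as [t|]; unfold gamma.
  - rewrite !bform_bvec_Some, bform_p_p0, bform_p_q0, bform_q_p0, bform_q_q0 by easy.
    unfold gamma_den in *; field; exact H.
  - simpl bvec; rewrite bform_p_p0, bform_q_p0 by easy.
    unfold gamma_den in *.
    set (x := z * inner (p a b z) (p a b 0)) in *; field; exact H.
Qed.

Lemma resolvent_iff (a b : nat -> R) (ha : forall n, (0 < a n)%R) (t : option R)
    (z : C) (hz : Im z <> 0%R) (h u : vect) :
  l2 (p a b 0) -> l2 (q a b 0) -> l2 (p a b z) -> l2 (q a b z) -> l2 h ->
  resolvent (Jt a b t) z h u <->
  u = vadd (vscal (gamma a b z t * inner h (p a b (Cconj z))) (p a b z)) (calR a b z h).
Proof.
  intros Hp0 Hq0 Hp Hq Hh.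
  pose proof (dmax_bvec a b ha t Hp0 Hq0) as Db.
  pose proof (bform_p_bvec_neq0 a b ha t z hz Hp0 Hq0 Hp) as B.
  pose proof (gamma_den_neq0 a b ha t z Hp0 Hq0 Hp B) as Hden.
  pose proof (gamma_spec a b ha t z Hp0 Hq0 Hp Hq Hden) as G.
  pose proof (dmax_p a b ha z Hp) as Dp.
  set (s := inner h (p a b (Cconj z))).
  (* The conjugation in [inner] undoes that of p(conj z), leaving the bilinear sum of
     [bform_calR]. *)
  assert (Es : s = CSeries (fun m => p a b z m * h m)).
  { apply CSeries_ext; intros n; rewrite p_conj, Cconj_conj by easy; ring. }
  set (w := calR a b z h).
  assert (Jw : forall n, calJ a b w n = z * w n + h n) by
    (apply calJ_calR; auto using l2_mul_summable).
  assert (Dw : dmax a b w) by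
    (apply dmax_source with z h; auto; now apply calR_bound).
  set (u0 := vadd _ _).
  assert (E0 : u0 = fun n => w n + (gamma a b z t * s) * p a b z n) by
    (apply functional_extensionality; intros n; unfold u0, vadd, vscal; ring).
  assert (D0 : dmax a b u0) by (rewrite E0; now apply dmax_linear).
  assert (B0 : bform a b u0 (bvec a b t) = 0).
  { rewrite E0, bform_linear by easy; unfold w.
    rewrite bform_calR, <- Es by easy.
    match type of G with ?x = _ => transitivity (s * x); [ring|rewrite G; ring] end. }
  assert (J0 : forall n, calJ a b u0 n = z * u0 n + h n).
  { intros n; rewrite E0, calJ_linear, Jw, calJ_p by easy; ring. }
  unfold resolvent; split.
  (* Uniqueness: the difference of two solutions is a multiple of p(z) that satisfies the boundary
     condition, whereas B(p(z), beta) is not 0. *)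
  - intros [v [Hv Eh]]; apply Jt_iff in Hv; try easy; destruct Hv as [[Du Bu] ->].
    set (d := fun n => u n + -(1) * u0 n).
    assert (Ed : forall n, d n = d O * p a b z n).
    { apply (calJ_eigen a b ha z); intros n; unfold d at 1.
      rewrite calJ_linear, J0, Eh; unfold d, vsub, vscal; ring. }
    assert (d0 : d O = 0).
    { assert (Bd : bform a b d (bvec a b t) = 0).
      { unfold d; rewrite bform_linear, Bu, B0 by easy; ring. }
      assert (Eb : bform a b d (bvec a b t) = d O * bform a b (p a b z) (bvec a b t)).
      { rewrite (bform_ext a b d (fun n => (p a b z n + -(1) * p a b z n) + d O * p a b z n)
          _ (bvec a b t)) by (easy || (intros n; rewrite (Ed n) at 1; ring)).
        rewrite (bform_linear a b (d O) (fun n => p a b z n + -(1) * p a b z n)), bform_linear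
          by (easy || now apply dmax_linear).
        ring. }
      rewrite Bd in Eb.
      destruct (classic (d O = 0)) as [|N]; [easy|].
      exfalso; apply (Cmult_neq_0 _ _ N B); now symmetry. }
    apply functional_extensionality; intros n.
    replace (u n) with (d n + u0 n) by (unfold d; ring).
    rewrite Ed, d0; ring.
  - intros ->; exists (calJ a b u0); split.
    + apply Jt_iff; auto.
    + apply functional_extensionality; intros n; unfold vsub, vscal; rewrite J0; ring.
Qed.

(** * The limit circle case *)

(** Green's identity for u and its conjugate; the boundary term vanishes with u (S N). It is the
    resolvent estimate for the truncated real symmetric matrix on the sites 0 to N. *)
Lemma energy_estimate (a b : nat -> R) (z : C) (u g : vect) (N : nat) :
  u (S N) = 0 -> (forall n, calJ a b u n = z * u n + g n) ->
  (Rabs (Im z) * sum_n (fun n => Cmod (u n) ^ 2) N <=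
   sum_n (fun n => Cmod (g n * u n)%C) N)%R.
Proof.
  intros H0 HJ.
  assert (G : (z - Cconj z) * RtoC (sum_n (fun n => (Cmod (u n) ^ 2)%R) N) =
    sum_n (fun n => u n * Cconj (g n) + -(1) * (g n * Cconj (u n))) N).
  { pose proof (green a b u (fun n => Cconj (u n)) N) as Gr.
    cbv beta in Gr; rewrite H0 in Gr.
    rewrite (csum_ext _ (fun n => (z - Cconj z) * RtoC (Cmod (u n) ^ 2) +
      -(1) * (u n * Cconj (g n) + -(1) * (g n * Cconj (u n))))) in Gr.
    - rewrite csum_linear, csum_scal, csum_RtoC in Gr.
      match type of Gr with ?x + _ * ?y = _ =>
        transitivity (y + (x + -(1) * y)); [ring|rewrite Gr] end.
      replace (Cconj 0) with (RtoC 0); [ring|].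
      unfold Cconj, RtoC; simpl; f_equal; ring.
    - intros n _; rewrite calJ_conj, HJ, Cmod2_conj, Cplus_conj, Cmult_conj; ring. }
  assert (Sp : (0 <= sum_n (fun n => Cmod (u n) ^ 2) N)%R).
  { eapply Rle_trans; [|apply (rsum_le (fun _ => 0%R)); intros; apply pow2_ge_0].
    rewrite sum_n_const; lra. }
  apply (f_equal Cmod) in G; rewrite Cmod_mult, Cmod_R, (Rabs_pos_eq _ Sp) in G.
  assert (Ez : Cmod (z - Cconj z) = (2 * Rabs (Im z))%R).
  { rewrite im_alt', !Cmod_mult, Cmod_Ci, !Cmod_R, Rabs_pos_eq; lra. }
  rewrite Ez in G.
  assert (B : (Cmod (sum_n (fun n => (u n * Cconj (g n) + -(1) * (g n * Cconj (u n)))%C) N)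
    <= 2 * sum_n (fun n => Cmod (g n * u n)%C) N)%R).
  { eapply Rle_trans; [apply Cmod_csum|]; rewrite <- rsum_scal; apply rsum_le; intros n _.
    eapply Rle_trans; [apply Cmod_triangle|].
    rewrite !Cmod_mult, Cmod_m1, !Cmod_conj; lra. }
  lra.
Qed.

Lemma finite_bounded_below (a b : nat -> R) (z : C) (u g : vect) (N : nat) :
  (forall n, (N <= n)%nat -> u n = 0) -> l2 g ->
  (forall n, calJ a b u n = z * u n + g n) ->
  (Im z ^ 2 * nrm2 u <= nrm2 g)%R.
Proof.
  intros Hu Hg HJ; assert (l2 u) as Lu by now apply l2_finite with N.
  pose proof (energy_estimate a b z u g N (Hu _ (Nat.le_succ_diag_r N)) HJ) as E.
  pose proof (Series_Cauchy_Schwarz g u Hg Lu) as CS.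
  rewrite <- (Series_finite (fun n => Cmod (u n) ^ 2)%R),
    <- (Series_finite (fun n => Cmod (g n * u n)%C)) in E.
  - fold (nrm2 u) in E; rewrite <- (pow2_abs (Im z)).
    pose proof (nrm2_nonneg u Lu) as P; pose proof (nrm2_nonneg g Hg).
    pose proof (Rabs_pos (Im z)).
    set (s := Series _) in *; set (y := Rabs (Im z)) in *.
    destruct (Req_dec (nrm2 u) 0) as [->|NZ]; [lra|].
    apply Rmult_le_reg_r with (nrm2 u); [lra|].
    assert ((y * nrm2 u) ^ 2 <= s ^ 2)%R; [|nra].
    apply pow_incr; split; [nra|easy].
  - intros n Hn; rewrite Hu, Cmult_0_r, Cmod_0 by lia; easy.
  - intros n Hn; rewrite Hu, Cmod_0 by lia; ring.
Qed.

(** h = (J - z)u is a limit of elements f_k of the range of [Jmin] - z. By [finite_bounded_below]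
    their preimages converge, to some y in the domain of the closure with (J - z)y = h; then u - y
    is a multiple of p(z) lying in l2, hence 0. *)
Lemma limit_point_clos (a b : nat -> R) (ha : forall n, (0 < a n)%R) (z : C) (u : vect) :
  Im z <> 0%R -> ~ l2 (p a b z) -> dmax a b u -> clos (Jmin a b) u (calJ a b u).
Proof.
  intros hz Hp [Hu Hju].
  set (h := fun n => calJ a b u n + - z * u n).
  assert (Hh : l2 h) by (now apply l2_plus, l2_scal).
  assert (EX : forall k : nat, exists f : vect,
    (exists N, forall n, (N <= n)%nat -> f n = 0) /\
    CSeries (fun m => p a b z m * f m) = 0 /\
    (nrm2 (fun n => (f n - h n)%C) <= / INR (S k))%R).
  { intros k; apply kernel_dense; try easy.
    apply Rinv_0_lt_compat, lt_0_INR; lia. }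
  set (f := fun k => proj1_sig (constructive_indefinite_description _ (EX k))).
  assert (Ff : forall k, (exists N, forall n, (N <= n)%nat -> f k n = 0) /\
    CSeries (fun m => p a b z m * f k m) = 0 /\
    (nrm2 (fun n => (f k n - h n)%C) <= / INR (S k))%R)
    by (intros k; unfold f; apply proj2_sig).
  clearbody f.
  assert (Lf : forall k, l2 (f k)) by
    (intros k; destruct (Ff k) as [[N HN] _]; now apply l2_finite with N).
  set (x := fun k => calR a b z (f k)).
  assert (Fx : forall k, exists N, forall n, (N <= n)%nat -> x k n = 0).
  { intros k; destruct (Ff k) as [[N HN] [S0 _]]; exists N; now apply calR_finite. }
  assert (Jx : forall k n, calJ a b (x k) n = z * x k n + f k n).
  { intros k; apply calJ_calR; [easy|].
    destruct (Ff k) as [[N HN] _]; apply summable_finite with N.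
    intros n Hn; rewrite HN by easy; ring. }
  assert (Lx : forall k, l2 (x k)) by
    (intros k; destruct (Fx k) as [N HN]; now apply l2_finite with N).
  assert (Y : (0 < Im z ^ 2)%R) by (apply pow2_gt_0; easy).
  assert (Lim : is_lim_seq (fun k => / INR (S k))%R 0%R).
  { apply (is_lim_seq_incr_1 (fun k => / INR k)%R).
    replace (Finite 0) with (Rbar_inv p_infty) by reflexivity.
    apply is_lim_seq_inv; [apply is_lim_seq_INR|easy]. }
  (* The rate combines |f_k - f_l|^2 <= 2|f_k - h|^2 + 2|f_l - h|^2 (norms in l2) with the lower
     bound (Im z)^2. *)
  destruct (l2_complete x (fun k => (2 / Im z ^ 2 * / INR (S k))%R) Lx) as [y [Hy Ly]].
  { intros k l.
    assert (D : (Im z ^ 2 * nrm2 (fun n => (x k n + -(1) * x l n)%C) <=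
      nrm2 (fun n => (f k n - f l n)%C))%R).
    { destruct (Fx k) as [N HN]; destruct (Fx l) as [M HM].
      apply finite_bounded_below with (a := a) (b := b) (N := (N + M)%nat).
      - intros n Hn; rewrite HN, HM by lia; ring.
      - now apply l2_minus.
      - intros n; rewrite calJ_linear, !Jx; ring. }
    rewrite (nrm2_ext _ (fun n => (x k n - x l n)%C)) in D by (intros; ring).
    assert (F : (nrm2 (fun n => (f k n - f l n)%C) <= 2 * / INR (S k) + 2 * / INR (S l))%R).
    { rewrite (nrm2_ext _ (fun n => ((f k n - h n) - (f l n - h n))%C)) by (intros; ring).
      destruct (Ff k) as [_ [_ Bk]]; destruct (Ff l) as [_ [_ Bl]].
      assert (l2 (fun n => (f k n - h n)%C)) by now apply l2_minus.
      assert (l2 (fun n => (f l n - h n)%C)) by now apply l2_minus.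
      eapply Rle_trans; [now apply l2_minus|]; lra. }
    apply Rmult_le_reg_l with (Im z ^ 2)%R; [easy|].
    replace (Im z ^ 2 * (2 / Im z ^ 2 * / INR (S k) + 2 / Im z ^ 2 * / INR (S l)))%R with
      (2 * / INR (S k) + 2 * / INR (S l))%R by (field; split; [|split]; try easy; apply not_0_INR; lia).
    lra. }
  { replace 0%R with (2 / Im z ^ 2 * 0)%R by ring.
    apply is_lim_seq_mult'; [apply is_lim_seq_const|exact Lim]. }
  assert (Cl : clos (Jmin a b) y (fun n => z * y n + h n)).
  { assert (Lzy : l2 (fun n => z * y n + h n)) by (apply l2_plus; [now apply l2_scal|easy]).
    assert (LJx : forall k, l2 (calJ a b (x k))).
    { intros k; apply l2_ext with (fun n => z * x k n + f k n); [intros n; now rewrite Jx|].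
      apply l2_plus; [now apply l2_scal|easy]. }
    split; [easy|split; [easy|]].
    exists x, (fun k => calJ a b (x k)); split; [intros k; split; [apply Fx|easy]|split].
    - apply l2norm_lim0; [intros k; now apply l2_minus|exact Ly].
    - apply l2norm_lim0; [intros k; now apply l2_minus|].
      apply lim0_le with (M := 1%R) (y := fun k =>
        (2 * (Cmod z ^ 2 * nrm2 (fun n => (x k n - y n)%C)) + 2 * / INR (S k))%R).
      + intros k; rewrite Rmult_1_l; split; [apply nrm2_nonneg; now apply l2_minus|].
        unfold vsub; rewrite (nrm2_ext _ (fun n => (z * (x k n - y n) + (f k n - h n))%C))
          by (intros; rewrite Jx; ring).
        assert (l2 (fun n => (x k n - y n)%C)) by now apply l2_minus.
        assert (l2 (fun n => (f k n - h n)%C)) by now apply l2_minus.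
        eapply Rle_trans; [apply l2_plus; [now apply l2_scal|easy]|].
        rewrite nrm2_scal; destruct (Ff k) as [_ [_ Bk]]; lra.
      + replace 0%R with (2 * (Cmod z ^ 2 * 0) + 2 * 0)%R by ring.
        apply is_lim_seq_plus'; repeat apply is_lim_seq_mult';
          auto using is_lim_seq_const. }
  pose proof (clos_Jmin_calJ a b y _ Cl) as Jy.
  set (d := fun n => u n + -(1) * y n).
  assert (Ed : forall n, d n = d O * p a b z n).
  { apply (calJ_eigen a b ha z); intros n; unfold d at 1.
    rewrite calJ_linear, <- Jy; unfold h, d; ring. }
  assert (d0 : d O = 0).
  { apply NNPP; intros ND; apply Hp.
    apply l2_ext with (fun n => / d O * d n).
    - intros n; rewrite (Ed n); field; exact ND.
    - apply l2_scal; now apply l2_plus, l2_scal. }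
  assert (E : u = y).
  { apply functional_extensionality; intros n.
    replace (u n) with (d n + y n) by (unfold d; ring); rewrite Ed, d0; ring. }
  rewrite E, <- Jy; exact Cl.
Qed.

Lemma limit_circle_p (a b : nat -> R) (ha : forall n, (0 < a n)%R) (z : C) :
  ~ op_eq (clos (Jmin a b)) (Jmax a b) -> Im z <> 0%R -> l2 (p a b z).
Proof.
  intros H hz; apply NNPP; intros Hp; apply H; intros u v; split.
  - intros Hc; pose proof (clos_Jmin_calJ a b u v Hc) as ->.
    destruct Hc as [Hu [Hv _]]; now repeat split.
  - intros [Hu [Hju ->]]; apply limit_point_clos with z; easy.
Qed.

(* Weyl's argument: the solution [q + m p] vanishing at [N + 1] has its l2 norm
   on [0, N] bounded independently of [N]. *)
Lemma l2_q_of_l2_p (a b : nat -> R) (ha : forall n, (0 < a n)%R) (z : C) :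
  Im z <> 0%R -> l2 (p a b z) -> l2 (q a b z).
Proof.
  intros hz Hp; pose proof (Rabs_pos_lt _ hz) as Y; set (y := Rabs (Im z)) in *.
  apply (ex_series_bounded _ (2 * (/ y) ^ 2 * (1 + nrm2 (p a b z)))); [intros; apply pow2_ge_0|].
  intros N.
  assert (P0 : forall u : vect, (Cmod (u O) ^ 2 <= sum_n (fun n => Cmod (u n) ^ 2) N)%R).
  { intros u; clear; induction N as [|N IH]; [rewrite sum_O; lra|].
    rewrite rsum_S; pose proof (pow2_ge_0 (Cmod (u (S N)))); lra. }
  assert (NZ : p a b z (S N) <> 0).
  { intros E.
    pose proof (energy_estimate a b z (p a b z) (fun _ => 0) N E) as EN; fold y in EN.
    rewrite (sum_n_ext (fun n => Cmod (0 * p a b z n)%C) (fun _ => 0%R)), sum_n_const in EN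
      by (intros; rewrite Cmult_0_l; apply Cmod_0).
    pose proof (P0 (p a b z)) as Q0; change (p a b z 0%nat) with (RtoC 1) in Q0.
    rewrite Cmod_1 in Q0.
    assert (y * sum_n (fun n => Cmod (p a b z n) ^ 2) N <= 0)%R; [|nra].
    rewrite <- (Rmult_0_r (INR (S N))); apply EN; intros n; rewrite calJ_p by easy; ring. }
  set (m := - (q a b z (S N) / p a b z (S N))).
  set (u := fun n => q a b z n + m * p a b z n).
  assert (u0 : u O = m).
  { unfold u; change (p a b z 0%nat) with (RtoC 1); change (q a b z 0%nat) with (RtoC 0); ring. }
  (* The source of u is [e0], so the right side of the energy estimate is |u_0| = |m|. *)
  assert (EN : (y * sum_n (fun n => Cmod (u n) ^ 2) N <= Cmod m)%R).
  { eapply Rle_trans; [apply (energy_estimate a b z u e0)|].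
    - unfold u, m; field; exact NZ.
    - intros n; unfold u; rewrite calJ_linear, calJ_q, calJ_p by easy; ring.
    - rewrite rsum_e0, u0; lra. }
  pose proof (P0 u) as Q0; rewrite u0 in Q0.
  set (s := sum_n (fun n => Cmod (u n) ^ 2)%R N) in *.
  pose proof (Cmod_ge_0 m) as M0.
  (* From |m|^2 = |u_0|^2 <= s and y s <= |m| follow |m| <= 1/y and s <= 1/y^2; writing q = u - m p
     then gives the claimed constant. *)
  assert (M1 : (Cmod m <= / y)%R).
  { apply Rmult_le_reg_l with y; [easy|]; rewrite Rinv_r by lra.
    destruct (Req_dec (Cmod m) 0) as [->|NM]; [lra|].
    apply Rmult_le_reg_r with (Cmod m); [lra|].
    pose proof (Rmult_le_compat_l y _ _ (Rlt_le _ _ Y) Q0); lra. }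
  assert (S1 : (s <= (/ y) ^ 2)%R).
  { apply Rmult_le_reg_l with y; [easy|].
    replace (y * (/ y) ^ 2)%R with (/ y)%R by (field; lra); lra. }
  apply Rle_trans with (sum_n (fun n => 2 * Cmod (u n) ^ 2 + 2 * Cmod m ^ 2 * Cmod (p a b z n) ^ 2)%R N).
  - apply rsum_le; intros n _.
    replace (q a b z n) with (u n + - m * p a b z n) by (unfold u; ring).
    eapply Rle_trans; [apply Cmod_sqr_plus|].
    rewrite Cmod_mult, Cmod_opp, Rpow_mult_distr; lra.
  - rewrite rsum_plus, !rsum_scal; fold s.
    pose proof (sum_n_le_Series _ N Hp (fun n => pow2_ge_0 _)) as Ps.
    fold (nrm2 (p a b z)) in Ps.
    assert (0 <= sum_n (fun n => Cmod (p a b z n) ^ 2) N)%R.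
    { eapply Rle_trans; [|apply (P0 (p a b z))]; apply pow2_ge_0. }
    assert (Cmod m ^ 2 <= (/ y) ^ 2)%R by (apply pow_incr; lra).
    set (pp := sum_n (fun n => (Cmod (p a b z n) ^ 2)%R) N) in *.
    assert (Cmod m ^ 2 * pp <= (/ y) ^ 2 * nrm2 (p a b z))%R; [|lra].
    apply Rmult_le_compat; try easy; apply pow2_ge_0.
Qed.

(* Variation of constants: with [u = al p + be q] on the sites [n] and [n + 1],
   the coefficients [al], [be] stay bounded by a convergent product. *)
Lemma l2_change_parameter (a b : nat -> R) (ha : forall n, (0 < a n)%R) (z w c : C)
    (u : vect) : l2 (p a b w) -> l2 (q a b w) ->
  (forall n, calJ a b u n = z * u n + c * e0 n) -> l2 u.
Proof.
  intros Hp Hq Hu.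
  set (P := p a b w) in *; set (Q := q a b w) in *.
  (* Cramer's rule for the two sites n and n + 1, whose determinant is the Wronskian 1. *)
  set (al := fun n => a n * (u n * Q (S n) - u (S n) * Q n)).
  set (be := fun n => a n * (u (S n) * P n - u n * P (S n))).
  assert (W : forall n, a n * (Q (S n) * P n - Q n * P (S n)) = 1) by
    (intros n; now apply wronskian with (b := b)).
  assert (U0 : forall n, u n = al n * P n + be n * Q n).
  { intros n; transitivity (u n * (a n * (Q (S n) * P n - Q n * P (S n))));
      [rewrite W|unfold al, be]; ring. }
  (* u (S n) is written with the coefficients of index n, so that the growth step bounds A (S n) by
     A n alone. *)
  assert (U1 : forall n, u (S n) = al n * P (S n) + be n * Q (S n)).
  { intros n; transitivity (u (S n) * (a n * (Q (S n) * P n - Q n * P (S n))));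
      [rewrite W|unfold al, be]; ring. }
  (* By Green's identity the coefficients change only through z - w: the source c e0 vanishes at
     index n + 1 and enters through the initial values. *)
  assert (Eb : forall n, be (S n) = be n + (z - w) * u (S n) * P (S n)).
  { intros n; unfold be; rewrite <- !green with (b := b); rewrite csum_S; f_equal.
    rewrite Hu; unfold P; rewrite calJ_p by easy; simpl e0; ring. }
  assert (Ea : forall n, al (S n) = al n - (z - w) * u (S n) * Q (S n)).
  { intros n.
    assert (X : forall n, al n = - (a n * (u (S n) * Q n - u n * Q (S n)))) by
      (intros k; unfold al; ring).
    rewrite !X, <- !green with (b := b); rewrite csum_S.
    rewrite Hu; unfold Q; rewrite calJ_q by easy; simpl e0; ring. }
  set (t := fun n => (Cmod (P n) + Cmod (Q n))%R).
  set (A := fun n => (Cmod (al n) + Cmod (be n))%R).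
  set (k := Cmod (z - w)).
  assert (t0 : forall n, (0 <= t n)%R) by
    (intros n; pose proof (Cmod_ge_0 (P n)); pose proof (Cmod_ge_0 (Q n)); unfold t; lra).
  assert (A0 : forall n, (0 <= A n)%R) by
    (intros n; pose proof (Cmod_ge_0 (al n)); pose proof (Cmod_ge_0 (be n)); unfold A; lra).
  assert (k0 : (0 <= k)%R) by apply Cmod_ge_0.
  assert (BU : forall x y p' q' : C,
    (Cmod (x * p' + y * q') <= (Cmod x + Cmod y) * (Cmod p' + Cmod q'))%R).
  { intros x y p' q'; eapply Rle_trans; [apply Cmod_triangle|]; rewrite !Cmod_mult.
    pose proof (Cmod_ge_0 x); pose proof (Cmod_ge_0 y);
      pose proof (Cmod_ge_0 p'); pose proof (Cmod_ge_0 q'); nra. }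
  assert (Hstep : forall n, (A (S n) <= A n * (1 + k * t (S n) ^ 2))%R).
  { intros n.
    assert (B1 : (Cmod (u (S n)) <= A n * t (S n))%R) by (rewrite U1; apply BU).
    assert (B2 : (Cmod (be (S n)) <= Cmod (be n) + k * Cmod (u (S n)) * Cmod (P (S n)))%R).
    { rewrite Eb; eapply Rle_trans; [apply Cmod_triangle|]; rewrite !Cmod_mult; unfold k; lra. }
    assert (B3 : (Cmod (al (S n)) <= Cmod (al n) + k * Cmod (u (S n)) * Cmod (Q (S n)))%R).
    { rewrite Ea; unfold Cminus at 1; eapply Rle_trans; [apply Cmod_triangle|].
      rewrite Cmod_opp, !Cmod_mult; unfold k; lra. }
    apply Rle_trans with (A n + k * Cmod (u (S n)) * t (S n))%R; [unfold A, t; lra|].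
    pose proof (Rmult_le_compat_l (k * t (S n)) _ _ (Rmult_le_pos _ _ k0 (t0 (S n))) B1).
    lra. }
  assert (St : ex_series (fun n => k * t n ^ 2)%R).
  { apply ex_series_le_R with (fun n => k * (2 * Cmod (P n) ^ 2 + 2 * Cmod (Q n) ^ 2))%R.
    - intros n; rewrite Rabs_pos_eq by (apply Rmult_le_pos; [easy|apply pow2_ge_0]).
      apply Rmult_le_compat_l; [easy|]; unfold t.
      pose proof (pow2_ge_0 (Cmod (P n) - Cmod (Q n))); nra.
    - auto using ex_series_scal_R, ex_series_plus_R. }
  (* Discrete Gronwall inequality: 1 + x <= exp x turns the product of the growth factors into the
     exponential of a convergent sum. *)
  assert (Ab : forall n, (A n <= A O * exp (sum_n (fun n => k * t n ^ 2) n))%R).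
  { assert (kt : forall n, (0 <= k * t n ^ 2)%R) by
      (intros; apply Rmult_le_pos; [easy|apply pow2_ge_0]).
    induction n as [|n IH].
    - rewrite sum_O; pose proof (exp_ineq1_le (k * t O ^ 2)); specialize (kt O).
      pose proof (A0 O); nra.
    - rewrite rsum_S, exp_plus, <- Rmult_assoc; eapply Rle_trans; [apply Hstep|].
      apply Rmult_le_compat; auto; [specialize (kt (S n)); lra|].
      apply exp_ineq1_le. }
  set (M := (A O * exp (Series (fun n => k * t n ^ 2)))%R).
  assert (Am : forall n, (A n <= M)%R).
  { intros n; eapply Rle_trans; [apply Ab|]; apply Rmult_le_compat_l; [easy|].
    assert (L : (sum_n (fun n => k * t n ^ 2)%R n <= Series (fun n => k * t n ^ 2))%R).
    { apply (sum_n_le_Series _ n St); intros; apply Rmult_le_pos; [easy|apply pow2_ge_0]. }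
    destruct L as [L|L]; [left; now apply exp_increasing|right; now rewrite L]. }
  apply ex_series_le_R with (fun n => M ^ 2 * (2 * Cmod (P n) ^ 2 + 2 * Cmod (Q n) ^ 2))%R.
  - intros n; rewrite Rabs_pos_eq by apply pow2_ge_0.
    assert (B1 : (Cmod (u n) <= M * t n)%R).
    { rewrite U0; eapply Rle_trans; [apply BU|]; apply Rmult_le_compat_r; [apply t0|apply Am]. }
    apply Rle_trans with ((M * t n) ^ 2)%R.
    + apply pow_incr; split; [apply Cmod_ge_0|easy].
    + rewrite Rpow_mult_distr; apply Rmult_le_compat_l; [apply pow2_ge_0|]; unfold t.
      pose proof (pow2_ge_0 (Cmod (P n) - Cmod (Q n))); nra.
  - auto using ex_series_scal_R, ex_series_plus_R.
Qed.

(** Division in C is total, so the non-vanishing of the denominator is asserted along with the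
    formula. Since [resolvent] is a relation, the equivalence contains both existence and uniqueness
    of the preimage of h under [Jt] - z. *)
Theorem theorem2p7 (a b : nat -> R) (ha : forall n, (0 < a n)%R)
    (limit_circle : ~ op_eq (clos (Jmin a b)) (Jmax a b))
    (t : option R) (z : C) (hz : Im z <> 0%R) :
  gamma_den a b z t <> RtoC 0 /\
  forall h : vect, l2 h ->
    forall u : vect,
      resolvent (Jt a b t) z h u <->
      u = vadd (vscal (Cmult (gamma a b z t) (inner h (p a b (Cconj z))))
                 (p a b z))
            (calR a b z h).
Proof.
  assert (Hp : l2 (p a b z)) by now apply limit_circle_p.
  assert (Hq : l2 (q a b z)) by now apply l2_q_of_l2_p.
  assert (Hp0 : l2 (p a b 0)).
  { apply l2_change_parameter with a b (RtoC 0) z (RtoC 0); auto using calJ_p_source. }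
  assert (Hq0 : l2 (q a b 0)).
  { apply l2_change_parameter with a b (RtoC 0) z (RtoC 1); auto using calJ_q_source. }
  split.
  - apply gamma_den_neq0; auto; now apply bform_p_bvec_neq0.
  - intros h Hh u; now apply resolvent_iff.
Qed.
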